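(* Let $\mu$ be a nonzero bounded $\mathbb{C}$-valued Borel measure on $[a,b]$, let $\lambda_1,\dots,\lambda_k\in\Lambda_\mu$ be pairwise distinct and let $m_1,\dots,m_k\in\mathbb{N}$ with $m_i\leq m(\mathscr{S}_\mu,\lambda_i)$ for $i\in\{1,\dots,k\}$. Put $n:=m_1+\dots+m_k$ and define $c=(c_0,\dots,c_n)\in\mathbb{C}^{n+1}$ by $$(\lambda-\lambda_1)^{m_1}\cdots(\lambda-\lambda_k)^{m_k}=c_n\lambda^n+\dots+c_1\lambda+c_0\qquad(\lambda\in\mathbb{C}),$$ and the differential operator $D_c:\mathscr{C}^n_{\mathbb{C}}([a,b])\to\mathscr{C}_{\mathbb{C}}([a,b])$ by $D_c(f):=c_nf^{(n)}+\dots+c_1f'+c_0f$. Let $\omega_c\in\mathscr{C}^n_{\mathbb{C}}(\mathbb{R})$ be the characteristic solution of $D_c(\omega)=0$. Finally, define $g:[a,b]\to\mathbb{C}$ by $$g(t):=\int_{[t,b]}\omega_c(x-t)\,d\mu(x).$$ Then, for all $f\in\mathscr{C}^n_{\mathbb{C}}([a,b])$, $$\mathscr{A}_\mu(f):=\int_{[a,b]}f(x)\,d\mu(x)=\int_{[a,b]}D_c(f)(t)\cdot g(t)\,dt.$$ In other words, $\mathscr{A}_\mu|_{\mathscr{C}^n_{\mathbb{C}}([a,b])}=C_g\circ D_c$, where $C_g:\mathscr{C}_{\mathbb{C}}([a,b])\to\mathbb{C}$ is given by $$C_g(h)=\int_{[a,b]}h(t)g(t)\,dt.$$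
   Context: $[a,b]$ is a compact interval; $\mathscr{C}^n_{\mathbb{C}}([a,b])$ is the space of $n$ times continuously differentiable complex-valued functions on $[a,b]$, and $\mathscr{C}_{\mathbb{C}}([a,b]):=\mathscr{C}^0_{\mathbb{C}}([a,b])$. $\mathbb{N}$ denotes the positive integers. For the measure $\mu$, the spectral function is the entire function $\mathscr{S}_\mu(\lambda):=\int_{[a,b]}e^{\lambda x}\,d\mu(x)$ ($\lambda\in\mathbb{C}$). The spectral set $\Lambda_\mu\subseteq\mathbb{C}$ is the set of zeros of $\mathscr{S}_\mu$. For $\lambda\in\Lambda_\mu$, $m(\mathscr{S}_\mu,\lambda)$ is the multiplicity of $\lambda$ as a zero of $\mathscr{S}_\mu$, i.e. the largest $m\in\mathbb{N}$ such that $\mathscr{S}_\mu^{(j)}(\lambda)=\int_{[a,b]}x^je^{\lambda x}\,d\mu(x)=0$ for all $j\in\{0,\dots,m-1\}$. The characteristic solution $\omega_c$ of $D_c(\omega)=0$ is the unique solution on $\mathbb{R}$ of the initial value problem $c_n\omega^{(n)}+\dots+c_1\omega'+c_0\omega=0$, $\omega^{(i)}(0)=\delta_{i,n-1}$ for $i\in\{0,\dots,n-1\}$, where $\delta$ is the Kronecker symbol. *)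

(* Defs.v *)
From mathcomp Require Import all_boot all_order all_algebra.
From mathcomp Require Import complex.
From mathcomp Require Import all_classical all_reals all_analysis.

Set Implicit Arguments.
Unset Strict Implicit.
Unset Printing Implicit Defensive.

Import Order.TTheory GRing.Theory Num.Theory.
Import numFieldNormedType.Exports.

Local Open Scope classical_set_scope.
Local Open Scope ring_scope.
Local Open Scope complex_scope.

(* The topology used on R[i] is that of R[i]^o, i.e. the one of the modulus. *)

Section complex_functions.
Context {R : realType}.

Definition cexp (z : R[i]) : R[i] :=
  (expR (complex.Re z))%:C * (cos (complex.Im z) +i* sin (complex.Im z)).

(* Difference quotients of f at x are taken along points of A only, so that
   for A = `[a, b] the derivative is one-sided at a and b and does not depend
   on the values of f outside A. *)
Definition diff_quot (f : R -> R[i]) (x y : R) : R[i]^o :=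
  (f y - f x) / (y - x)%:C.

Definition derivable_on (A : set R) (f : R -> R[i]) (x : R) : Prop :=
  cvg (diff_quot f x y @[y --> within A x^']).

Definition derive_on (A : set R) (f : R -> R[i]) (x : R) : R[i] :=
  lim (diff_quot f x y @[y --> within A x^']).

Definition derive_onn (A : set R) (n : nat) (f : R -> R[i]) : R -> R[i] :=
  iter n (derive_on A) f.

Definition Cn_on (A : set R) (n : nat) (f : R -> R[i]) : Prop :=
  (forall i, (i < n)%N -> forall x, A x -> derivable_on A (derive_onn A i f) x)
  /\ {within A, continuous (derive_onn A n f : R -> R[i]^o)}.

(* Only the values of f on A matter; A is `[a, b] or the whole line. *)
Definition diff_op (A : set R) (n : nat) (c : 'I_n.+1 -> R[i])
    (f : R -> R[i]) (t : R) : R[i] :=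
  \sum_(i < n.+1) c i * derive_onn A i f t.

Definition characteristic_solution (n : nat) (c : 'I_n.+1 -> R[i])
    (w : R -> R[i]) : Prop :=
  [/\ Cn_on setT n w,
      (forall t, diff_op setT c w t = 0) &
      forall i, (i < n)%N -> derive_onn setT i w 0 = (i == n.-1)%:R].

Definition leb_cint (A : set R) (f : R -> R[i]) : R[i] :=
  (\int[lebesgue_measure]_(x in A) complex.Re (f x)) +i*
  (\int[lebesgue_measure]_(x in A) complex.Im (f x)).

End complex_functions.

Section complex_measures.
Context {R : realType}.

(* A complex Borel measure is given by its real and imaginary parts, which are
   finite signed measures; boundedness is automatic. *)
Record complex_measure := ComplexMeasure {
  cm_re : {charge set (measurableTypeR R) -> \bar R} ;
  cm_im : {charge set (measurableTypeR R) -> \bar R} }.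

Definition cm_val (mu : complex_measure) (A : set R) : R[i] :=
  fine (cm_re mu A) +i* fine (cm_im mu A).

(* The integral against a signed measure is the difference of the integrals
   against its positive and negative variations; the latter do not depend on
   the chosen Hahn decomposition. *)
Definition charge_int (nu : {charge set (measurableTypeR R) -> \bar R})
    (A : set R) (f : R -> R) : R :=
  let nuPN := svalP (cid (svalP (cid (Hahn_decomposition nu)))) in
  (\int[jordan_pos nuPN]_(x in A) f x) - (\int[jordan_neg nuPN]_(x in A) f x).

Definition cint (mu : complex_measure) (A : set R) (f : R -> R[i]) : R[i] :=
  let u x := complex.Re (f x) in let v x := complex.Im (f x) in
  (charge_int (cm_re mu) A u - charge_int (cm_im mu) A v) +i*
  (charge_int (cm_im mu) A u + charge_int (cm_re mu) A v).

(* A measure on [a, b] is represented by any Borel measure on the line that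
   restricts to it: only its values on Borel subsets of [a, b] are ever used. *)
Definition nonzero_on (a b : R) (mu : complex_measure) : Prop :=
  exists A : set (measurableTypeR R),
    [/\ measurable A, A `<=` `[a, b] & cm_val mu A != 0].

Definition spectral_fun (a b : R) (mu : complex_measure) (z : R[i]) : R[i]^o :=
  cint mu `[a, b] (fun x => cexp (z * x%:C)).

Definition spectral_set (a b : R) (mu : complex_measure) : set R[i] :=
  [set z | spectral_fun a b mu z = 0].

End complex_measures.

(* Both functionals depend on their argument only through its values on
   [a, b]. *)
Section functionals.
Context {R : realType}.

Definition A_fun (a b : R) (mu : complex_measure) (f : R -> R[i]) : R[i] :=
  cint mu `[a, b] f.

Definition C_fun (a b : R) (g : R -> R[i]) (h : R -> R[i]) : R[i] :=
  leb_cint `[a, b] (fun t => h t * g t).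

End functionals.

Section zeros.
Context {R : realType}.

Definition vanishes_to (S : R[i] -> R[i]^o) (z : R[i]) (m : nat) : Prop :=
  forall j, (j < m)%N -> derive1n j S z = 0.

(* The largest m > 0 such that S vanishes to order m at z; it is 0 if S z != 0
   and, by convention, if there is no largest m, which happens at no zero of a
   nonzero entire function. *)
Definition multiplicity (S : R[i] -> R[i]^o) (z : R[i]) : nat :=
  xget 0%N [set m | [/\ (0 < m)%N, vanishes_to S z m &
                       forall m', vanishes_to S z m' -> (m' <= m)%N]].

End zeros.

(* Main.v *)
(* With [P = \prod_i (X - lam i)^(m i)], Lagrange's identity gives, for each x,
   a function [B x] of t, bilinear in the derivatives of f at t and of w at
   x - t, such that d/dt (B x t) = w (x - t) (D_c f) t and B x x = f x. Hence

     f x = B x a + \int_[a, x] w (x - t) (D_c f)(t) dt.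

   As a function of x, [B x a] is a combination of translates of derivatives of
   w, all of which P(d/dx) annihilates. A Bezout argument splits such a function
   into solutions of (d/dx - lam i)^(m i) u = 0, that is into combinations of
   the x^j e^(lam i x) with j < m i, whose integrals against mu are the
   derivatives S_mu^(j) (lam i) = 0. So only the integral term contributes to
   A_mu f, and exchanging the order of integration over a <= t <= x <= b turns
   it into \int (D_c f) g. *)
Require Import Defs.
From mathcomp Require Import all_boot all_order all_algebra.
From mathcomp Require Import complex.
From mathcomp Require Import all_classical all_reals all_analysis.
From mathcomp Require Import measurable_realfun.
From mathcomp Require Import ring lra zify.
Set Implicit Arguments.
Unset Strict Implicit.
Unset Printing Implicit Defensive.

Import Order.TTheory GRing.Theory Num.Theory.
Import numFieldNormedType.Exports ComplexField.Normc.
Local Open Scope classical_set_scope.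
Local Open Scope ring_scope.
Local Open Scope complex_scope.

Local Notation Re := (@complex.Re _).
Local Notation Im := (@complex.Im _).

(** * Integration of complex-valued functions *)

(** Four obstacles shape the development. The multiplicities speak of complex derivatives of S_mu,
    whereas the argument needs the integrals of x^j e^(lam x). The link is a remainder estimate for
    the exponential, quadratic in the increment and uniform on [a, b], combined with the boundedness
    of mu as a functional for the sup norm. The Bezout cofactors have no prescribed degree, so
    splitting a solution may call for derivatives of any order, while [w] is only given as C^n.
    Hence the detour through infinite sequences of successive derivatives. The function f lives on
    [a, b] only, with one-sided derivatives at the ends. Lagrange's identity is therefore
    differentiated at interior points and integrated with continuity up to the ends. Finally [g]
    need not be continuous: for n = 1 it jumps at the atoms of mu. Its integrability against D_c f
    must come out of Fubini's theorem itself. Apart from these, the theory of linear differential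
    equations enters only through the fact that a function with zero derivative is constant. *)

Lemma Re_add (R : realType) (x y : R[i]) :
  Re (x + y) = Re x + Re y.
Proof. by case: x y => [? ?] [? ?]. Qed.

Lemma Im_add (R : realType) (x y : R[i]) :
  Im (x + y) = Im x + Im y.
Proof. by case: x y => [? ?] [? ?]. Qed.

Lemma Re_mul (R : realType) (x y : R[i]) : Re (x * y) =
  Re x * Re y - Im x * Im y.
Proof. by case: x y => [? ?] [? ?]. Qed.

Lemma Im_mul (R : realType) (x y : R[i]) : Im (x * y) =
  Re x * Im y + Im x * Re y.
Proof. by case: x y => [? ?] [? ?]. Qed.

Lemma complexP (R : realType) (x y : R[i]) :
  Re x = Re y -> Im x = Im y -> x = y.
Proof. by case: x y => [? ?] [? ?] /= -> ->. Qed.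

(** Stated by components to match [mint] and [is_cderive], so that results on real functions apply
    to each part. *)
Definition ccont {R : realType} (A : set R) (f : R -> R[i]) : Prop :=
  {within A, continuous (Re \o f)} /\
  {within A, continuous (Im \o f)}.

(** Common form of [leb_cint], which is the instance for Lebesgue measure by unfolding, and of the
    pieces of [cint]. One set of linearity lemmas serves both sides of the exchange of integrals. *)
Definition mint {R : realType}
    (nu : {measure set (measurableTypeR R) -> \bar R})
    (A : set R) (f : R -> R[i]) : R[i] :=
  (\int[nu]_(x in A) Re (f x)) +i*
  (\int[nu]_(x in A) Im (f x)).

Definition cintegrable {R : realType}
    (nu : {measure set (measurableTypeR R) -> \bar R})
    (A : set R) (f : R -> R[i]) : Prop :=
  nu.-integrable A (EFin \o (Re \o f)) /\
  nu.-integrable A (EFin \o (Im \o f)).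

Section complex_integral.
Context {R : realType}.
Variable nu : {measure set (measurableTypeR R) -> \bar R}.
Variable A : set (measurableTypeR R).
Hypothesis mA : measurable A.

Lemma cintegrableD f g : cintegrable nu A f -> cintegrable nu A g ->
  cintegrable nu A (fun x => f x + g x).
Proof.
move=> [fr fi] [gr gi]; split.
- rewrite (_ : _ \o _ = (EFin \o (Re \o f)) \+
    (EFin \o (Re \o g)))%E; first exact: integrableD.
  by apply/funext => x; rewrite /= Re_add EFinD.
- rewrite (_ : _ \o _ = (EFin \o (Im \o f)) \+
    (EFin \o (Im \o g)))%E; first exact: integrableD.
  by apply/funext => x; rewrite /= Im_add EFinD.
Qed.

Lemma mintD f g : cintegrable nu A f -> cintegrable nu A g ->
  mint nu A (fun x => f x + g x) = mint nu A f + mint nu A g.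
Proof.
move=> [fr fi] [gr gi]; apply: complexP; rewrite /mint /=.
- by under eq_Rintegral do rewrite Re_add; rewrite RintegralD.
- by under eq_Rintegral do rewrite Im_add; rewrite RintegralD.
Qed.

Let integrableZ (r : R) (u : R -> R) : nu.-integrable A (EFin \o u) ->
  nu.-integrable A (EFin \o (fun x => r * u x)).
Proof.
move=> iu; rewrite (_ : _ \o _ = (fun x => r%:E * (EFin \o u) x))%E.
  exact: integrableZl.
by apply/funext => x; rewrite /= EFinM.
Qed.

Lemma cintegrableZ (k : R[i]) f : cintegrable nu A f ->
  cintegrable nu A (fun x => k * f x).
Proof.
move=> [fr fi]; split.
- rewrite (_ : _ \o _ =
    (EFin \o (fun x => Re k * (Re \o f) x)%R) \+
    (EFin \o (fun x => - Im k * (Im \o f) x)%R))%E.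
    by apply: integrableD => //; exact: integrableZ.
  by apply/funext => x; rewrite /= Re_mul -EFinD mulNr.
- rewrite (_ : _ \o _ =
    (EFin \o (fun x => Re k * (Im \o f) x)%R) \+
    (EFin \o (fun x => Im k * (Re \o f) x)%R))%E.
    by apply: integrableD => //; exact: integrableZ.
  by apply/funext => x; rewrite /= Im_mul -EFinD.
Qed.

Lemma mintZ (k : R[i]) f : cintegrable nu A f ->
  mint nu A (fun x => k * f x) = k * mint nu A f.
Proof.
move=> [fr fi]; apply: complexP; rewrite ?Re_mul ?Im_mul /mint /=.
- under eq_Rintegral do rewrite Re_mul -mulNr.
  by rewrite RintegralD ?RintegralZl ?mulNr//; exact: integrableZ.
- under eq_Rintegral do rewrite Im_mul.
  by rewrite RintegralD ?RintegralZl//; exact: integrableZ.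
Qed.

Lemma cintegrable_sum (I : Type) (s : seq I) (F : I -> R -> R[i]) :
  (forall i, cintegrable nu A (F i)) ->
  cintegrable nu A (fun x => \sum_(i <- s) F i x).
Proof.
move=> iF; elim: s => [|i s IH].
  rewrite (_ : (fun _ => _) = (fun=> 0)); last first.
    by apply/funext => x; rewrite big_nil.
  by split; apply: integrable0.
rewrite (_ : (fun _ => _) = (fun x => F i x + \sum_(i <- s) F i x)).
  exact: cintegrableD.
by apply/funext => x; rewrite big_cons.
Qed.

Lemma mint_sum (I : Type) (s : seq I) (F : I -> R -> R[i]) :
  (forall i, cintegrable nu A (F i)) ->
  mint nu A (fun x => \sum_(i <- s) F i x) = \sum_(i <- s) mint nu A (F i).
Proof.
move=> iF; elim: s => [|i s IH].
  rewrite (_ : (fun _ => _) = (fun=> 0)); last first.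
    by apply/funext => x; rewrite big_nil.
  by rewrite big_nil /mint /= /Rintegral integral0.
rewrite (_ : (fun _ => _) = (fun x => F i x + \sum_(i <- s) F i x)).
  by rewrite mintD ?IH ?big_cons//; exact: cintegrable_sum.
by apply/funext => x; rewrite big_cons.
Qed.

End complex_integral.

Lemma eq_mint (R : realType)
    (nu : {measure set (measurableTypeR R) -> \bar R}) (A : set R) f g :
  (forall x, A x -> f x = g x) -> mint nu A f = mint nu A g.
Proof.
by move=> fg; rewrite /mint; congr Complex;
  apply: eq_Rintegral => x /set_mem /fg ->.
Qed.

Lemma continuous_within_integrable (R : realType)
    (nu : {finite_measure set (measurableTypeR R) -> \bar R}) (a b : R)
    (u : R -> R) :
  {within `[a, b], continuous u} -> nu.-integrable `[a, b] (EFin \o u).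
Proof.
move=> cu; apply: measurable_bounded_integrable.
- exact: measurable_itv.
- by rewrite ltey_eq fin_num_measure.
- exact: subspace_continuous_measurable_fun.
- have /compact_bounded[M [Mr HM]] :=
    continuous_compact cu (@segment_compact _ a b).
  exists M; split => // N MN x abx; apply: (HM _ MN).
  by exists x.
Qed.

Lemma ccont_integrable (R : realType)
    (nu : {finite_measure set (measurableTypeR R) -> \bar R}) (a b : R)
    (f : R -> R[i]) :
  ccont `[a, b] f -> cintegrable nu `[a, b] f.
Proof. by move=> [? ?]; split; exact: continuous_within_integrable. Qed.

(** Hides the Hahn decomposition: from here on, only the existence of two finite measures with this
    difference matters. *)
Lemma charge_intE (R : realType)
    (nu : {charge set (measurableTypeR R) -> \bar R}) :
  exists p q : {finite_measure set (measurableTypeR R) -> \bar R},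
  forall A f, charge_int nu A f =
    (\int[p]_(x in A) f x) - (\int[q]_(x in A) f x).
Proof.
pose nuPN := svalP (cid (svalP (cid (Hahn_decomposition nu)))).
by exists (jordan_pos nuPN), (jordan_neg nuPN).
Qed.

(* The four measures are the positive and negative variations of the real and
   of the imaginary part. *)
Lemma cint_mint (R : realType) (mu : @complex_measure R) :
  exists (e : 'I_4 -> R[i])
    (nu : 'I_4 -> {finite_measure set (measurableTypeR R) -> \bar R}),
  forall A f, cint mu A f = \sum_k e k * mint (nu k) A f.
Proof.
have [p1 [q1 E1]] := charge_intE (cm_re mu).
have [p2 [q2 E2]] := charge_intE (cm_im mu).
exists (fun k => nth 0 [:: 1; -1; 'i; - 'i] k),
  (fun k => nth p1 [:: p1; q1; p2; q2] k).
move=> A f; rewrite !big_ord_recr big_ord0 /= add0r.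
apply: complexP; rewrite !(Re_add, Im_add, Re_mul, Im_mul) /mint /cint !E1 !E2.
- by rewrite /=; ring.
- by rewrite /=; ring.
Qed.

Lemma normc_le (R : realType) (z : R[i]) : normc z <= `|Re z| + `|Im z|.
Proof.
case: z => x y /=; rewrite -(ler_pXn2r (n := 2)) ?nnegrE ?sqrtr_ge0 ?addr_ge0//.
rewrite sqr_sqrtr ?addr_ge0 ?sqr_ge0// sqrrD !real_normK ?num_real//.
by rewrite addrAC lerDl mulrn_wge0// mulr_ge0.
Qed.

Lemma Im_le_normc (R : realType) (z : R[i]) : `|Im z| <= normc z.
Proof.
case: z => x y /=; rewrite -(ler_pXn2r (n := 2)) ?nnegrE ?sqrtr_ge0//.
by rewrite sqr_sqrtr ?addr_ge0 ?sqr_ge0// real_normK ?num_real// lerDr sqr_ge0.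
Qed.

Lemma Re_le_normc (R : realType) (z : R[i]) : `|Re z| <= normc z.
Proof. by have := complex.normc_ge_Re z; rewrite -lecR. Qed.

Lemma normc_ge0 (R : realType) (z : R[i]) : 0 <= normc z.
Proof. exact: le_trans (Re_le_normc z). Qed.

Section ccont.
Context {R : realType}.
Variable A : set R.

Lemma ccont_cst (k : R[i]) : ccont A (fun=> k).
Proof. by split => x; exact: cvg_cst. Qed.

Lemma ccontD f g : ccont A f -> ccont A g -> ccont A (fun x => f x + g x).
Proof.
move=> [fr fi] [gr gi]; split.
- rewrite (_ : _ \o _ = (fun x => (Re \o f) x + (Re \o g) x)); last first.
    by apply/funext => x; rewrite /= Re_add.
  by move=> x; apply: continuousD; [exact: fr|exact: gr].
- rewrite (_ : _ \o _ = (fun x => (Im \o f) x + (Im \o g) x)); last first.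
    by apply/funext => x; rewrite /= Im_add.
  by move=> x; apply: continuousD; [exact: fi|exact: gi].
Qed.

Lemma ccontM f g : ccont A f -> ccont A g -> ccont A (fun x => f x * g x).
Proof.
move=> [fr fi] [gr gi]; split.
- rewrite (_ : _ \o _ = (fun x => (Re \o f) x * (Re \o g) x -
    (Im \o f) x * (Im \o g) x)); last by apply/funext => x; rewrite /= Re_mul.
  by move=> x; apply: cvgB; apply: cvgM;
    [exact: fr|exact: gr|exact: fi|exact: gi].
- rewrite (_ : _ \o _ = (fun x => (Re \o f) x * (Im \o g) x +
    (Im \o f) x * (Re \o g) x)); last by apply/funext => x; rewrite /= Im_mul.
  by move=> x; apply: cvgD; apply: cvgM;
    [exact: fr|exact: gi|exact: fi|exact: gr].
Qed.

Lemma ccont_sum (I : Type) (s : seq I) (F : I -> R -> R[i]) :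
  (forall i, ccont A (F i)) -> ccont A (fun x => \sum_(i <- s) F i x).
Proof.
move=> cF; elim: s => [|i s IH].
  rewrite (_ : (fun _ => _) = (fun=> 0)); first exact: ccont_cst.
  by apply/funext => x; rewrite big_nil.
rewrite (_ : (fun _ => _) = (fun x => F i x + \sum_(i <- s) F i x)).
  exact: ccontD.
by apply/funext => x; rewrite big_cons.
Qed.

End ccont.

Section cint.
Context {R : realType}.
Variables (mu : @complex_measure R) (a b : R).
Implicit Types f g : R -> R[i].
Let E : set R := `[a, b].
Let mE : measurable (E : set (measurableTypeR R)).
Proof. exact: measurable_itv. Qed.

Lemma eq_cint (A : set R) f g :
  (forall x, A x -> f x = g x) -> cint mu A f = cint mu A g.
Proof.
have [e [nu muE]] := cint_mint mu; move=> fg; rewrite !muE.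
by apply: eq_bigr => k _; rewrite (eq_mint _ fg).
Qed.

Lemma cintD f g : ccont E f -> ccont E g ->
  cint mu E (fun x => f x + g x) = cint mu E f + cint mu E g.
Proof.
have [e [nu muE]] := cint_mint mu; move=> cf cg; rewrite !muE -big_split /=.
by apply: eq_bigr => k _; rewrite (mintD mE) ?mulrDr//; exact: ccont_integrable.
Qed.

Lemma cintZ k f : ccont E f -> cint mu E (fun x => k * f x) = k * cint mu E f.
Proof.
have [e [nu muE]] := cint_mint mu; move=> cf; rewrite !muE mulr_sumr.
by apply: eq_bigr => j _; rewrite (mintZ mE _ (ccont_integrable _ cf)) mulrCA.
Qed.

Lemma cint_sum (I : Type) (s : seq I) (F : I -> R -> R[i]) :
  (forall i, ccont E (F i)) ->
  cint mu E (fun x => \sum_(i <- s) F i x) = \sum_(i <- s) cint mu E (F i).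
Proof.
have [e [nu muE]] := cint_mint mu; move=> cF; rewrite muE.
under [RHS]eq_bigr do rewrite muE.
rewrite exchange_big; apply: eq_bigr => k _ /=.
by rewrite (mint_sum mE) ?mulr_sumr// => i; exact: ccont_integrable.
Qed.

(** The factor 2 pays for estimating the modulus by the sum of the absolute values of the two parts;
    any finite constant would do. *)
Lemma mint_bound (nu : {finite_measure set (measurableTypeR R) -> \bar R})
    f (M : R) : ccont E f -> (forall x, E x -> normc (f x) <= M) ->
  normc (mint nu E f) <= (fine (nu E) *+ 2) * M.
Proof.
move=> cf fM; have [ir ii] := ccont_integrable nu cf.
have iM : nu.-integrable E (EFin \o (fun=> M)).
  by apply: continuous_within_integrable => x; exact: cvg_cst.
have bnd u : nu.-integrable E (EFin \o u) ->
    (forall x, E x -> `|u x| <= M) ->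
    `|\int[nu]_(x in E) u x| <= fine (nu E) * M.
  move=> iu uM; apply: le_trans (le_normr_Rintegral _ iu) _ => //.
  rewrite mulrC -Rintegral_cst//; apply: le_Rintegral => //.
  by have := integrable_norm iu.
apply: le_trans (normc_le _) _; rewrite mulrnAl mulr2n /mint /=.
by apply: lerD; apply: bnd => // x Ex; apply: le_trans (fM _ Ex);
  [exact: Re_le_normc|exact: Im_le_normc].
Qed.

(** Continuity of the functional for the sup norm. The constant is independent of [f], which is what
    allows differentiation under the integral sign. *)
Lemma cint_bound : exists2 K : R, 0 <= K & forall f (M : R), ccont E f ->
  (forall x, E x -> normc (f x) <= M) -> normc (cint mu E f) <= K * M.
Proof.
have [e [nu muE]] := cint_mint mu.
exists (\sum_k normc (e k) * (fine (nu k E) *+ 2)).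
  by apply: sumr_ge0 => k _; rewrite mulr_ge0 ?normc_ge0// mulrn_wge0// fine_ge0.
move=> f M cf fM; rewrite muE mulr_suml.
apply: (big_ind2 (fun x y => normc x <= y)) => [|x1 x2 y1 y2 h1 h2|k _].
- by rewrite normc0.
- by apply: le_trans (le_normcD _ _) _; exact: lerD.
- by rewrite normcM -mulrA ler_wpM2l ?normc_ge0// mint_bound.
Qed.

End cint.

(** * Differentiation of complex-valued functions of a real variable *)

Definition is_cderive {R : realType} (f : R -> R[i]) (x : R) (d : R[i]) :
    Prop :=
  is_derive x (1 : R) (Re \o f) (Re d) /\ is_derive x (1 : R) (Im \o f) (Im d).

Section cderive.
Context {R : realType}.
Implicit Types (f g : R -> R[i]) (x : R).

Lemma cvg_Re_Im (T : Type) (F : set_system T) {FF : Filter F}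
    (g : T -> R[i]^o) (l : R[i]^o) : g @ F --> l ->
  (fun t => Re (g t)) @ F --> Re l /\ (fun t => Im (g t)) @ F --> Im l.
Proof.
move=> /cvgrPdist_lt gl; split; apply/cvgrPdist_lt => e e0.
- have := gl e%:C; rewrite ltcR => /(_ e0); apply: filterS => t.
  by rewrite [`|_|](_ : _ = (normc (l - g t))%:C)// ltcR; apply: le_lt_trans;
    apply: le_trans (Re_le_normc _); case: (l) (g t) => [? ?] [? ?].
- have := gl e%:C; rewrite ltcR => /(_ e0); apply: filterS => t.
  by rewrite [`|_|](_ : _ = (normc (l - g t))%:C)// ltcR; apply: le_lt_trans;
    apply: le_trans (Im_le_normc _); case: (l) (g t) => [? ?] [? ?].
Qed.

Lemma Re_div_real (z : R[i]) (r : R) : Re (z / r%:C) = Re z / r.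
Proof.
rewrite (_ : (r%:C)^-1 = (r^-1)%:C) ?Re_mul/= ?mulr0 ?subr0//.
by rewrite fmorphV.
Qed.

Lemma Im_div_real (z : R[i]) (r : R) : Im (z / r%:C) = Im z / r.
Proof.
rewrite (_ : (r%:C)^-1 = (r^-1)%:C) ?Im_mul/= ?mulr0 ?add0r//.
by rewrite fmorphV.
Qed.

Lemma derivable_on_Re_Im (A : set R) f x : derivable_on A f x ->
  (Re (f y) - Re (f x)) / (y - x) @[y --> within A x^'] -->
    Re (derive_on A f x) /\
  (Im (f y) - Im (f x)) / (y - x) @[y --> within A x^'] -->
    Im (derive_on A f x).
Proof.
move=> df; have [/= hr hi] := cvg_Re_Im df; split.
- apply: cvg_trans hr; apply: near_eq_cvg; near=> y.
  by rewrite /diff_quot Re_div_real; case: (f y) (f x) => [? ?] [? ?].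
- apply: cvg_trans hi; apply: near_eq_cvg; near=> y.
  by rewrite /diff_quot Im_div_real; case: (f y) (f x) => [? ?] [? ?].
Unshelve. all: by end_near. Qed.

Lemma diff_quot_is_derive (u : R -> R) x (l : R) :
  (u y - u x) / (y - x) @[y --> x^'] --> l -> is_derive x (1 : R) u l.
Proof.
move=> ul.
have {}ul : h^-1 *: (u (h *: (1 : R) + x) - u x) @[h --> 0^'] --> l.
  have hx : h + x @[h --> (0 : R)^'] --> x^'.
    move=> P [e /= e0 eP]; exists e => // h /= he h0.
    apply: eP => /=; last by rewrite -subr_eq0 addrK.
    by rewrite opprD addrCA subrr addr0; rewrite /= sub0r in he.
  have := cvg_comp _ _ hx ul; apply: cvg_trans; apply: near_eq_cvg; near=> h => /=.
  by rewrite addrK /GRing.scale /= mulr1 mulrC.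
by split; [apply/cvg_ex; exists l|exact: cvg_lim].
Unshelve. all: by end_near. Qed.

(** At an interior point the punctured neighbourhoods within [A] are the ordinary ones, so the
    relative derivative is the two-sided one. *)
Lemma derivable_on_is_cderive (A : set R) f x : nbhs x A ->
  derivable_on A f x -> is_cderive f x (derive_on A f x).
Proof.
move=> xA df; have [hr hi] := derivable_on_Re_Im df.
have xA' : x^' `=>` within A x^'.
  move=> P; rewrite /within /= => AP.
  have : x^' A by apply: filterS xA.
  by move: AP; apply: filterS2 => y; apply.
by split; apply: diff_quot_is_derive; [apply: cvg_trans hr|apply: cvg_trans hi];
  exact: cvg_app xA'.
Qed.

(** Covers the endpoints of an interval too, where only one-sided quotients converge: u y is the
    quotient times (y - x), plus u x. *)
Lemma derivable_on_ccont (A : set R) f :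
  (forall x, A x -> derivable_on A f x) -> ccont A f.
Proof.
suff cont (u : R -> R) (l : R -> R) : (forall x, A x ->
    (u y - u x) / (y - x) @[y --> within A x^'] --> l x) ->
    {within A, continuous u}.
  move=> df; split.
  - apply: (cont _ (fun x => Re (derive_on A f x))) => x Ax.
    by have [] := derivable_on_Re_Im (df x Ax).
  - apply: (cont _ (fun x => Im (derive_on A f x))) => x Ax.
    by have [] := derivable_on_Re_Im (df x Ax).
move=> ul; apply/subspace_continuousP => x Ax.
have yx : y - x @[y --> within A x^'] --> 0.
  rewrite -(subrr x); apply: cvgB; last exact: cvg_cst.
  apply: cvg_trans (@cvg_id _ (nbhs x)) => P [e e0 eP].
  by exists e => // y ? _ _; apply: eP.
have uy : u y @[y --> within A x^'] --> u x.
  have : (u y - u x) / (y - x) * (y - x) + u x @[y --> within A x^'] -->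
      l x * 0 + u x.
    by apply: cvgD; [exact: cvgM (ul x Ax) yx|exact: cvg_cst].
  rewrite mulr0 add0r; apply: cvg_trans; apply: near_eq_cvg.
  have : x^' (fun y => y != x) by exists 1 => /=.
  by apply: filterS => y yx' _; rewrite divfK ?subrK// subr_eq0.
(* The limit [uy] ignores y = x; the point itself is put back by [nbhs_singleton]. *)
move=> P uP.
have AP : nbhs x (fun y => y != x -> A y -> P (u y)) by exact: (uy _ uP).
have : nbhs x (fun y => A y -> P (u y)).
  apply: filterS AP => y yP Ay; have [->|yx'] := eqVneq y x.
    exact: nbhs_singleton.
  exact: yP.
exact.
Qed.

Lemma is_cderive_eq f x d d' : is_cderive f x d -> d = d' -> is_cderive f x d'.
Proof. by move=> ? <-. Qed.

Lemma is_cderive_cst (k : R[i]) x : is_cderive (fun=> k) x 0.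
Proof. by split; exact: is_derive_cst. Qed.

Lemma is_cderiveD f g x df dg : is_cderive f x df -> is_cderive g x dg ->
  is_cderive (fun y => f y + g y) x (df + dg).
Proof.
move=> [fr fi] [gr gi]; split.
- rewrite Re_add (_ : _ \o _ = (Re \o f) + (Re \o g)); first exact: is_deriveD.
  by apply/funext => y; rewrite /= Re_add.
- rewrite Im_add (_ : _ \o _ = (Im \o f) + (Im \o g)); first exact: is_deriveD.
  by apply/funext => y; rewrite /= Im_add.
Qed.

Lemma is_cderiveM f g x df dg : is_cderive f x df -> is_cderive g x dg ->
  is_cderive (fun y => f y * g y) x (df * g x + f x * dg).
Proof.
move=> [fr fi] [gr gi]; split.
- rewrite (_ : _ \o _ = (Re \o f) * (Re \o g) - (Im \o f) * (Im \o g)).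
    apply: is_derive_eq; rewrite Re_add !Re_mul /GRing.scale /=; ring.
  by apply/funext => y; rewrite /= Re_mul.
- rewrite (_ : _ \o _ = (Re \o f) * (Im \o g) + (Im \o f) * (Re \o g)).
    apply: is_derive_eq; rewrite Im_add !Im_mul /GRing.scale /=; ring.
  by apply/funext => y; rewrite /= Im_mul.
Qed.

Lemma is_cderiveZ (k : R[i]) f x d :
  is_cderive f x d -> is_cderive (fun y => k * f y) x (k * d).
Proof.
move=> df; have := is_cderiveM (is_cderive_cst k x) df.
by rewrite mul0r add0r.
Qed.

Lemma is_cderive_sum (I : Type) (s : seq I) (F dF : I -> R -> R[i]) x :
  (forall i, is_cderive (F i) x (dF i x)) ->
  is_cderive (fun y => \sum_(i <- s) F i y) x (\sum_(i <- s) dF i x).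
Proof.
move=> hF; elim: s => [|i s IH].
  rewrite big_nil (_ : (fun _ => _) = (fun=> 0)); first exact: is_cderive_cst.
  by apply/funext => y; rewrite big_nil.
rewrite big_cons (_ : (fun _ => _) = (fun y => F i y + \sum_(i <- s) F i y)).
  exact: is_cderiveD.
by apply/funext => y; rewrite big_cons.
Qed.

Lemma is_cderive_comp f (u : R -> R) x d (du : R) :
  is_cderive f (u x) d -> is_derive x (1 : R) u du ->
  is_cderive (fun y => f (u y)) x (d * du%:C).
Proof.
move=> [fr fi] hu; split.
- rewrite Re_mul /= mulr0 subr0.
  exact: (is_derive1_comp (f := Re \o f)).
- rewrite Im_mul /= mulr0 add0r.
  exact: (is_derive1_comp (f := Im \o f)).
Qed.

Lemma is_cderive_continuous f x d : is_cderive f x d ->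
  {for x, continuous (Re \o f)} /\ {for x, continuous (Im \o f)}.
Proof.
by move=> [[dr _] [di _]]; split; apply/differentiable_continuous/derivable1_diffP.
Qed.

Lemma is_cderive_ccont f (df : R -> R[i]) (A : set R) :
  (forall x, is_cderive f x (df x)) -> ccont A f.
Proof.
move=> fdf; split; apply: continuous_subspaceT => x;
  by have [] := is_cderive_continuous (fdf x).
Qed.

Lemma is_cderive0_cst f : (forall x, is_cderive f x 0) ->
  forall x y, f x = f y.
Proof.
move=> f0 x y; apply: complexP.
- by apply: (@is_derive_0_is_cst _ (Re \o f)) => z; have [] := f0 z.
- by apply: (@is_derive_0_is_cst _ (Im \o f)) => z; have [] := f0 z.
Qed.

End cderive.

(** * The complex exponential and the derivatives of the spectral function *)

Section complex_exponential.
Context {R : realType}.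
Implicit Types (z w : R[i]) (x u v : R).

Lemma cexpD z w : cexp (z + w) = cexp z * cexp w.
Proof.
rewrite /cexp Re_add Im_add expRD cosD sinD.
by apply: complexP; rewrite !(Re_mul, Im_mul) /=; ring.
Qed.

Lemma cexp0 : cexp (0 : R[i]) = 1.
Proof. by rewrite /cexp /= expR0 cos0 sin0 mul1r. Qed.

Lemma normc_cexp z : normc (cexp z) = expR (Re z).
Proof.
rewrite normcM /= expr0n /= addr0 sqrtr_sqr cos2Dsin2 sqrtr1 mulr1.
by rewrite ger0_norm ?expR_ge0.
Qed.

Lemma is_cderive_ofreal x : is_cderive (fun y : R => y%:C) x 1.
Proof. by split; [exact: is_derive_id|exact: is_derive_cst]. Qed.

Lemma is_cderive_cexp z x :
  is_cderive (fun y => cexp (z * y%:C)) x (z * cexp (z * x%:C)).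
Proof.
have hu (k : R) : is_derive x (1 : R) (fun y : R => k * y) k.
  rewrite (_ : (fun y : R => _) = k \*: id); last by apply/funext.
  by apply: is_derive_eq; rewrite /GRing.scale /= mulr1.
have he := is_derive1_comp (f := expR) (is_derive_expR _) (hu (Re z)).
have hc := is_derive1_comp (f := cos) (is_derive_cos _) (hu (Im z)).
have hs := is_derive1_comp (f := sin) (is_derive_sin _) (hu (Im z)).
split.
- rewrite (_ : _ \o _ = (expR \o (fun y : R => Re z * y)) *
    (cos \o (fun y : R => Im z * y))).
    apply: is_derive_eq; rewrite /cexp !(Re_mul, Im_mul) /GRing.scale /=.
    by rewrite !mulr0 !mul0r !subr0 !add0r; ring.
  apply/funext => y; rewrite /= /cexp !(Re_mul, Im_mul) /=.
  by rewrite !mulr0 !mul0r !subr0 !add0r.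
- rewrite (_ : _ \o _ = (expR \o (fun y : R => Re z * y)) *
    (sin \o (fun y : R => Im z * y))).
    apply: is_derive_eq; rewrite /cexp !(Re_mul, Im_mul) /GRing.scale /=.
    by rewrite !mulr0 !mul0r !subr0 !add0r !addr0; ring.
  apply/funext => y; rewrite /= /cexp !(Re_mul, Im_mul) /=.
  by rewrite !mulr0 !mul0r !subr0 !add0r addr0.
Qed.

Lemma norm_sin_le v : `|sin v| <= `|v|.
Proof.
wlog v0 : v / 0 <= v.
  move=> H; have [/H//|/ltW v0] := leP 0 v.
  by rewrite -normrN -sinN -[in leRHS]normrN H// oppr_ge0.
move: v0; rewrite le_eqVlt => /predU1P[<-|v0]; first by rewrite sin0.
have cs : {within `[0, v], continuous (@sin R)}.
  by apply: continuous_subspaceT => ?; exact: continuous_sin.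
have [c _] := MVT v0 (fun t _ => is_derive_sin t) cs.
rewrite sin0 !subr0 => ->; rewrite normrM ler_piMl// cos_max//.
Qed.

Lemma norm_cos_sub1 v : `|cos v - 1| <= v ^+ 2.
Proof.
have -> : cos v - 1 = - (2 * sin (v / 2) ^+ 2).
  have -> : v = v / 2 + v / 2 by field.
  rewrite cosD -!expr2 cos2sin2.
  rewrite (_ : v / 2 + v / 2 = v); last by field.
  ring.
rewrite normrN normrM normrX (_ : v ^+ 2 = 2 * (v ^+ 2 / 2)); last by field.
rewrite ger0_norm// ler_wpM2l//.
apply: (@le_trans _ _ (`|v / 2| ^+ 2)).
  by rewrite lerXn2r ?nnegrE// norm_sin_le.
rewrite real_normK ?num_real// exprMn ler_wpM2l ?sqr_ge0//.
lra.
Qed.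

(** The mean value theorem gives sin v - v = (cos c - 1) v with 0 < c < v, and c^2 <= v because v <=
    1. *)
Lemma norm_sin_sub v : `|v| <= 1 -> `|sin v - v| <= v ^+ 2.
Proof.
wlog v0 : v / 0 <= v.
  move=> H v1; have [/H->//|/ltW v0] := leP 0 v.
  have := H (- v); rewrite oppr_ge0 normrN sqrrN sinN opprK => /(_ v0 v1).
  by rewrite distrC addrC.
move: v0; rewrite le_eqVlt => /predU1P[<-|v0 v1].
  by rewrite sin0 subrr normr0 expr0n.
have cs : {within `[0, v], continuous (fun t : R => sin t - t)}.
  apply: continuous_subspaceT => t; apply: cvgB; first exact: continuous_sin.
  exact: cvg_id.
have ds t : t \in `]0, v[ ->
    is_derive t (1 : R) (fun t : R => sin t - t) (cos t - 1).
  by move=> _; apply: is_deriveB.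
have [c /andP[]] := MVT v0 ds cs.
rewrite !bnd_simp => c0 cv; rewrite sin0 !subr0 => ->.
rewrite normrM expr2 (gtr0_norm v0) ler_wpM2r ?(ltW v0)//.
apply: (le_trans (norm_cos_sub1 c)).
move: v1; rewrite gtr0_norm// => v1; nra.
Qed.

(** The inequality 1 + u <= e^u applied to -u gives e^u <= 1 / (1 - u), so the remainder is at most
    u^2 / (1 - u), and 1 - u >= 1/2. *)
Lemma norm_expR_sub u : u <= 2^-1 -> `|expR u - 1 - u| <= 2 * u ^+ 2.
Proof.
move=> u2; have h1 := expR_ge1Dx u; rewrite ger0_norm; last lra.
have h2 := expR_ge1Dx (- u); rewrite expRN in h2.
have e0 := expR_gt0 u.
have : (1 - u) * expR u <= 1.
  by rewrite -[leRHS](mulVf (lt0r_neq0 e0)) ler_wpM2r ?(ltW e0).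
nra.
Qed.

(** The real part of the remainder contributes at most 4 |w|^2 and the imaginary part at most 3
    |w|^2; 8 is a convenient round constant. *)
Lemma normc_cexp_sub w : normc w <= 2^-1 ->
  normc (cexp w - 1 - w) <= 8 * normc w ^+ 2.
Proof.
move=> w2; set n := normc w.
have := Re_le_normc w; have := Im_le_normc w.
rewrite -/n; set u := Re w; set v := Im w => vn un.
have un' := le_trans un w2; have vn' := le_trans vn w2.
have u2 : u <= 2^-1 by apply: le_trans un'; exact: ler_norm.
have eu := norm_expR_sub u2.
have cv := norm_cos_sub1 v.
have sv := norm_sin_sub (le_trans vn' _); have {}sv : `|sin v - v| <= v ^+ 2.
  by apply: sv; lra.
have sv' := norm_sin_le v.
have u2n : u ^+ 2 <= n ^+ 2.
  by rewrite -(real_normK (num_real u)) lerXn2r ?nnegrE// normc_ge0.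
have v2n : v ^+ 2 <= n ^+ 2.
  by rewrite -(real_normK (num_real v)) lerXn2r ?nnegrE// normc_ge0.
apply: le_trans (normc_le _) _.
have -> : Re (cexp w - 1 - w) =
    (expR u - 1 - u) * cos v + (1 + u) * (cos v - 1).
  rewrite /cexp -/u -/v.
  case: (w) @u @v {eu cv sv sv' u2n v2n vn un vn' un' u2} => u v /=.
  ring.
have -> : Im (cexp w - 1 - w) = (expR u - 1) * sin v + (sin v - v).
  rewrite /cexp -/u -/v.
  case: (w) @u @v {eu cv sv sv' u2n v2n vn un vn' un' u2} => u v /=.
  ring.
have e1 : `|(expR u - 1 - u) * cos v + (1 + u) * (cos v - 1)| <=
    2 * u ^+ 2 + 2 * v ^+ 2.
  apply: le_trans (ler_normD _ _) _; rewrite !normrM; apply: lerD.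
    apply: le_trans eu; rewrite ler_piMr// cos_max//.
  apply: ler_pM => //; apply: le_trans (ler_normD _ _) _; rewrite normr1.
  lra.
have e2 : `|(expR u - 1) * sin v + (sin v - v)| <= 2 * n ^+ 2 + v ^+ 2.
  apply: le_trans (ler_normD _ _) _; apply: lerD => //; rewrite normrM.
  have n0 : 0 <= n by exact: normc_ge0.
  have -> : 2 * n ^+ 2 = (2 * n) * n by ring.
  apply: ler_pM => //; last exact: le_trans sv' vn.
  have -> : expR u - 1 = (expR u - 1 - u) + u by ring.
  apply: le_trans (ler_normD _ _) _.
  apply: (@le_trans _ _ (2 * u ^+ 2 + n)); first exact: lerD.
  have : n ^+ 2 <= n * 2^-1 by rewrite expr2 ler_wpM2l.
  lra.
have := sqr_ge0 n; lra.
Qed.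

End complex_exponential.

Section moments.
Context {R : realType}.
Variables (mu : @complex_measure R) (a b : R).
Let E : set R := `[a, b].

Lemma ccont_expmono (j : nat) (z : R[i]) :
  ccont E (fun x => x%:C ^+ j * cexp (z * x%:C)).
Proof.
apply: ccontM; last by apply: is_cderive_ccont => x; exact: is_cderive_cexp.
elim: j => [|j IH].
  rewrite (_ : (fun _ => _) = (fun=> 1)); first exact: ccont_cst.
  by apply/funext => x; rewrite expr0.
rewrite (_ : (fun _ => _) = (fun x : R => x%:C * x%:C ^+ j)).
  by apply: ccontM => //; apply: is_cderive_ccont => x; exact: is_cderive_ofreal.
by apply/funext => x; rewrite exprS.
Qed.

Definition moment (j : nat) (z : R[i]) : R[i]^o :=
  cint mu E (fun x => x%:C ^+ j * cexp (z * x%:C)).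

(** First-order Taylor expansion in z, obtained by integrating x^j e^(z x) (e^(h x) - 1 - h x)
    against the measure. *)
Lemma moment_expansion (j : nat) (z : R[i]) : exists K X : R,
  [/\ 0 < K, 0 < X & forall h : R[i], normc h <= X ->
   normc (moment j (h + z) - moment j z - h * moment j.+1 z) <=
     K * normc h ^+ 2].
Proof.
have [K K0 muK] := cint_bound mu a b.
pose X := Num.max `|a| `|b| + 1.
have X0 : 0 < X by rewrite ltr_wpDl// le_max normr_ge0.
have EX x : E x -> `|x| <= X.
  rewrite /E /= in_itv /= => /andP[ax xb]; apply: ler_wpDr => //.
  rewrite le_max !ler_norml.
  have := ler_norm a; have := ler_norm (- a); have := ler_norm b.
  by have := ler_norm (- b); rewrite !normrN; have [x0|x0] := leP 0 x; lra.
(* The three factors bound x^j, e^(z x) and, up to |h|^2, the remainder at h x, for |x| <= X. *)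
pose M := X ^+ j * (expR (normc z * X) * (8 * X ^+ 2)).
have M0 : 0 <= M.
  by rewrite !mulr_ge0// ?expR_ge0// ?exprn_ge0// ltW.
(* Adding 1 makes the constant positive, since it is divided by later; the radius ensures |h x| <=
   1/2, the range of [normc_cexp_sub]. *)
exists (K * M + 1), (2^-1 / X); split => [||h hX].
- by rewrite ltr_wpDl// mulr_ge0.
- by rewrite divr_gt0.
have -> : moment j (h + z) - moment j z - h * moment j.+1 z =
    cint mu E (fun x => x%:C ^+ j * cexp ((h + z) * x%:C) +
      ((-1) * (x%:C ^+ j * cexp (z * x%:C)) +
       (- h) * (x%:C ^+ j.+1 * cexp (z * x%:C)))).
  have c1 := ccont_expmono j (h + z); have c2 := ccont_expmono j z.
  have c3 := ccont_expmono j.+1 z.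
  have c2' := ccontM (ccont_cst E (-1)) c2.
  have c3' := ccontM (ccont_cst E (- h)) c3.
  rewrite cintD//; last exact: ccontD.
  by rewrite cintD// !cintZ// mulN1r mulNr addrA.
apply: (@le_trans _ _ (K * (M * normc h ^+ 2))).
  apply: muK.
    apply: ccontD; first exact: ccont_expmono.
    by apply: ccontD; apply: ccontM; [exact: ccont_cst|exact: ccont_expmono
      |exact: ccont_cst|exact: ccont_expmono].
  move=> x Ex.
  have -> : x%:C ^+ j * cexp ((h + z) * x%:C) +
      (-1 * (x%:C ^+ j * cexp (z * x%:C)) +
       - h * (x%:C ^+ j.+1 * cexp (z * x%:C))) =
      x%:C ^+ j * (cexp (z * x%:C) * (cexp (h * x%:C) - 1 - h * x%:C)).
    by rewrite mulrDl cexpD exprS; ring.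
  have nx : normc x%:C = `|x| by rewrite /= expr0n /= addr0 sqrtr_sqr.
  have nX (k : nat) (w : R[i]) : normc (w ^+ k) = normc w ^+ k.
    by elim: k => [|k IH]; rewrite ?expr0 ?normc1// !exprS normcM IH.
  have xX := EX _ Ex.
  rewrite normcM nX nx [normc (cexp (z * _) * _)]normcM normc_cexp.
  have -> : M * normc h ^+ 2 =
    X ^+ j * (expR (normc z * X) * (8 * (normc h * X) ^+ 2)).
    by rewrite /M; ring.
  apply: ler_pM; rewrite ?exprn_ge0 ?mulr_ge0 ?expR_ge0 ?normc_ge0//.
    by rewrite lerXn2r ?nnegrE// ltW.
  apply: ler_pM; rewrite ?expR_ge0 ?normc_ge0//.
    rewrite ler_expR; apply: le_trans (ler_norm _) _.
    apply: le_trans (Re_le_normc _) _; rewrite normcM nx.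
    by rewrite ler_wpM2l ?normc_ge0.
  have hx : normc (h * x%:C) <= normc h * X.
    by rewrite normcM nx ler_wpM2l ?normc_ge0.
  apply: le_trans (normc_cexp_sub _) _.
    by apply: le_trans hx _; rewrite -ler_pdivlMr.
  by rewrite ler_wpM2l// lerXn2r ?nnegrE ?normc_ge0// mulr_ge0 ?normc_ge0// ltW.
by rewrite mulrA ler_wpM2r ?exprn_ge0 ?normc_ge0// lerDl.
Qed.

Lemma derive1_moment (j : nat) (z : R[i]) :
  (moment j)^`()%classic z = moment j.+1 z.
Proof.
have [K [X [K0 X0 mE]]] := moment_expansion j z.
rewrite derive1E /derive; apply: cvg_lim => //.
apply/cvgrPdist_lt => e e0.
(* A positive element of [R[i]] is real, so the estimate takes place in [R]. *)
have [e1 e1E] : exists e1 : R, e = e1%:C.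
  by exists (Re e); rewrite RRe_real// gtr0_real.
move: e0; rewrite {}e1E ltcR => e0.
(* Below [X] the expansion applies; below [e1 / K] the error K |h| of the difference quotient is
   less than [e1]. *)
exists (Num.min X (e1 / K))%:C => /=.
  by rewrite ltcR lt_min X0 divr_gt0.
move=> h /=; rewrite sub0r normrN.
rewrite [`|h|](_ : _ = (normc h)%:C)// ltcR lt_min => /andP[hX he] h0.
rewrite [`|_|](_ : _ = (normc (moment j.+1 z -
  h^-1 *: (moment j (h *: 1 + z) - moment j z)))%:C)// ltcR.
rewrite /GRing.scale /= mulr1.
have -> : moment j.+1 z - h^-1 * (moment j (h + z) - moment j z) =
    - (h^-1 * (moment j (h + z) - moment j z - h * moment j.+1 z)).
  by rewrite [in RHS]mulrDr mulrN mulKf//; ring.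
have nh0 : 0 < normc h.
  rewrite lt_neqAle normc_ge0 andbT eq_sym.
  by apply: contra h0 => /eqP/eq0_normc ->.
rewrite normcN normcM normcV mulrC ltr_pdivrMr//.
apply: le_lt_trans (mE _ (ltW hX)) _.
by rewrite expr2 mulrA ltr_pM2r// mulrC -ltr_pdivlMr.
Qed.

Lemma derive1n_spectral (j : nat) :
  (spectral_fun a b mu)^`(j)%classic = moment j.
Proof.
elim: j => [|j IH].
  apply/funext => z; rewrite derive1n0 /spectral_fun /moment.
  by apply: eq_cint => x _; rewrite expr0 mul1r.
by rewrite derive1nS IH; apply/funext => z; exact: derive1_moment.
Qed.

Lemma moment_eq0 (z : R[i]) (m j : nat) :
  (m <= multiplicity (spectral_fun a b mu) z)%N -> (j < m)%N ->
  moment j z = 0.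
Proof.
(* In the second case no largest order exists, [multiplicity] is 0, and j < m <= 0 is absurd. *)
rewrite /multiplicity; case: xgetP => [p _ [_ vp _] mp jm|_].
  by rewrite -derive1n_spectral; apply: vp; exact: leq_trans mp.
by rewrite leqn0 => /eqP ->.
Qed.

End moments.

(** * Constant coefficient operators and the functions annihilated by mu *)

(** A smooth function bundled with all its derivatives: differentiating is a shift of the index. *)
Definition jet {R : realType} (h : nat -> R -> R[i]) : Prop :=
  forall k x, is_cderive (h k) x (h k.+1 x).

(* On a jet [h], whose [h k] is the k-th derivative of [h 0], this is the action
   of the constant coefficient differential operator P(d/dx). *)
Definition pact {R : realType} (P : {poly R[i]}) (h : nat -> R -> R[i])
    (k : nat) (x : R) : R[i] :=
  \sum_(i < size P) P`_i * h (k + i)%N x.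

Section polynomial_action.
Context {R : realType}.
Implicit Types (P Q : {poly R[i]}) (h : nat -> R -> R[i]).

Lemma pact_widen P h k x n : (size P <= n)%N ->
  pact P h k x = \sum_(i < n) P`_i * h (k + i)%N x.
Proof.
move=> Pn; rewrite /pact (big_ord_widen n (fun i => P`_i * h (k + i)%N x))//.
rewrite big_mkcond; apply: eq_bigr => i _; case: ifPn => //.
by rewrite -leqNgt => /(nth_default 0) ->; rewrite mul0r.
Qed.

Lemma pactD P Q h k x : pact (P + Q) h k x = pact P h k x + pact Q h k x.
Proof.
pose n := maxn (size P) (size Q).
have PQn : (size (P + Q)%R <= n)%N by exact: size_polyD.
rewrite (pact_widen _ _ _ PQn) (pact_widen _ _ _ (leq_maxl _ (size Q))).
rewrite (pact_widen _ _ _ (leq_maxr (size P) _)).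
by rewrite -big_split; apply: eq_bigr => i _; rewrite coefD mulrDl.
Qed.

Lemma pactZ (c : R[i]) P h k x : pact (c *: P) h k x = c * pact P h k x.
Proof.
rewrite (@pact_widen (c *: P) h k x (size P)) ?size_scale_leq//.
by rewrite mulr_sumr; apply: eq_bigr => i _; rewrite coefZ mulrA.
Qed.

Lemma pact1 h k x : pact 1 h k x = h k x.
Proof. by rewrite /pact size_poly1 big_ord1 coef1 mul1r addn0. Qed.

Lemma pactMX P h k x : pact (P * 'X) h k x = pact P h k.+1 x.
Proof.
rewrite (@pact_widen _ h k x (size P).+1) ?size_polyMX_leq//; last first.
  by apply: leq_trans (size_polyMleq _ _) _; rewrite size_polyX addn2.
rewrite big_ord_recl coefMX mul0r add0r; apply: eq_bigr => i _.
by rewrite coefMX /= /bump /= add1n addnS.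
Qed.

(** Products of polynomials act as compositions of operators. Horner induction on [P] suffices,
    since 'X acts as the shift of orders and constants act by scaling. *)
Lemma pactM P Q h k x : pact (P * Q) h k x = pact P (pact Q h) k x.
Proof.
elim/poly_ind: P k => [|P c IH] k.
  by rewrite mul0r /pact size_poly0 !big_ord0.
rewrite mulrDl mulrAC !pactD !pactMX IH; congr (_ + _).
by rewrite mul_polyC pactZ -[c%:P]mulr1 mul_polyC pactZ pact1.
Qed.

Lemma jet_pact P h : jet h -> jet (pact P h).
Proof.
move=> jh k x.
apply: (@is_cderive_sum _ _ _ (fun i : 'I_(size P) => fun y => P`_i * h (k + i)%N y)
  (fun i : 'I_(size P) => fun y => P`_i * h (k.+1 + i)%N y)) => i.
by apply: is_cderiveZ; exact: jh.
Qed.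

Lemma pact_eq0 P h : (forall k x, h k x = 0) -> forall k x, pact P h k x = 0.
Proof. by move=> h0 k x; rewrite /pact big1// => i _; rewrite h0 mulr0. Qed.

Lemma is_cderive_powS (j : nat) (x : R) :
  is_cderive (fun y : R => y%:C ^+ j.+1) x (j.+1%:R * x%:C ^+ j).
Proof.
elim: j => [|j IH].
  by rewrite expr0 mulr1; exact: is_cderive_ofreal.
rewrite (_ : (fun _ => _) = (fun y : R => y%:C * y%:C ^+ j.+1)); last first.
  by apply/funext => y; rewrite exprS.
apply: is_cderive_eq (is_cderiveM (is_cderive_ofreal x) IH) _.
by rewrite (exprS _ j) -[j.+2]addn1 natrD; ring.
Qed.

Lemma jet_polynomial (m : nat) h : jet h -> (forall x, h m x = 0) ->
  exists d : nat -> R[i], forall x, h 0%N x = \sum_(j < m) d j * x%:C ^+ j.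
Proof.
elim: m h => [|m IH] h jh hm; first by exists (fun=> 0) => x; rewrite big_ord0.
have [d dE] := IH (fun k => h k.+1) (fun k => jh k.+1) hm.
pose p (x : R) := \sum_(j < m) (d j / j.+1%:R) * x%:C ^+ j.+1.
have dp x : is_cderive p x (h 1%N x).
  rewrite dE; apply: (@is_cderive_sum _ _ _ (fun j : 'I_m => fun y : R =>
    d j / j.+1%:R * y%:C ^+ j.+1) (fun j : 'I_m => fun y => d j * y%:C ^+ j)) => j.
  apply: is_cderive_eq (is_cderiveZ _ (is_cderive_powS j x)) _.
  by rewrite mulrA divfK// pnatr_eq0.
have d0 x : is_cderive (fun y => h 0%N y + (-1) * p y) x 0.
  apply: is_cderive_eq (is_cderiveD (jh 0%N x) (is_cderiveZ _ (dp x))) _.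
  by rewrite mulN1r subrr.
(* The coefficients of the antiderivative [p], completed by the constant value of h 0 - p, read off
   at 0. *)
exists (fun j => if j is j'.+1 then d j' / j'.+1%:R else h 0%N 0 + -1 * p 0) => x.
have -> : h 0%N x = (h 0%N 0 + -1 * p 0) + p x.
  by rewrite -(is_cderive0_cst d0 x 0); ring.
by rewrite big_ord_recl /= expr0 mulr1; congr (_ + _).
Qed.

End polynomial_action.

Section annihilation.
Context {R : realType}.
Variables (mu : @complex_measure R) (a b : R).
Let E : set R := `[a, b].

(** The solutions range over the whole line, which makes the class stable under translation. Asking
    for the equation at every order [k] lets a further operator be applied to it by [pact_eq0]
    without differentiating again. *)
Definition annihilates (P : {poly R[i]}) : Prop :=
  forall h : nat -> R -> R[i], jet h -> (forall k x, pact P h k x = 0) ->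
  cint mu E (h 0%N) = 0.

Let jet_ccont (h : nat -> R -> R[i]) k : jet h -> ccont E (h k).
Proof. by move=> jh; apply: is_cderive_ccont => x; exact: jh. Qed.

Lemma cint_eq0 (f : R -> R[i]) : (forall x, f x = 0) -> cint mu E f = 0.
Proof.
move=> f0; rewrite (_ : f = (fun=> 0 * 0)); last first.
  by apply/funext => x; rewrite f0 mul0r.
by rewrite (cintZ _ _ (ccont_cst _ _)) mul0r.
Qed.

Lemma annihilates1 : annihilates 1.
Proof.
by move=> h jh h0; apply: cint_eq0 => x; have := h0 0%N x; rewrite pact1.
Qed.

(* A Bezout relation U P + V Q = 1 splits a solution of PQ(d/dx) h = 0 into a
   solution of Q(d/dx) h = 0 and a solution of P(d/dx) h = 0. *)
Lemma annihilatesM (P Q : {poly R[i]}) : coprimep P Q ->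
  annihilates P -> annihilates Q -> annihilates (P * Q).
Proof.
move=> /Bezout_eq1_coprimepP[[U V] /= UV] aP aQ h jh hPQ.
have hE x : h 0%N x = pact (U * P) h 0%N x + pact (V * Q) h 0%N x.
  by rewrite -pactD UV pact1.
rewrite (eq_cint mu (fun x _ => hE x)).
rewrite cintD; [|exact: jet_ccont (jet_pact _ jh)..].
rewrite aQ; [rewrite aP ?addr0//|exact: jet_pact|].
- exact: jet_pact.
- move=> k x; rewrite -pactM mulrCA pactM; exact: pact_eq0.
- move=> k x; rewrite -pactM mulrCA [Q * P]mulrC pactM; exact: pact_eq0.
Qed.

(** Multiplication by e^(-l x) conjugates d/dx - l into d/dx, so it turns a solution into a function
    with vanishing m-th derivative, that is, a polynomial of degree less than m. *)
Lemma annihilates_XsubC_exp (l : R[i]) (m : nat) :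
  (forall j, (j < m)%N -> moment mu a b j l = 0) ->
  annihilates (('X - l%:P) ^+ m).
Proof.
move=> ml h jh hm.
(* The derivative of e^(-l x) u is e^(-l x) (d/dx - l) u, so each [v k.+1] is the derivative of
   [v k]. *)
pose v k x := cexp (- l * x%:C) * pact (('X - l%:P) ^+ k) h 0%N x.
have jv : jet v.
  move=> k x; apply: is_cderive_eq (is_cderiveM (is_cderive_cexp _ _)
    (jet_pact _ jh 0%N x)) _.
  rewrite /v exprSr mulrBr [_ * l%:P]mulrC mul_polyC -scaleNr.
  by rewrite pactD pactMX pactZ; ring.
have vm x : v m x = 0 by rewrite /v hm mulr0.
have [d dE] := jet_polynomial jv vm.
have hE x : h 0%N x = \sum_(j < m) d j * (x%:C ^+ j * cexp (l * x%:C)).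
  under eq_bigr do rewrite mulrA; rewrite -mulr_suml -dE /v expr0 pact1.
  by rewrite mulrAC -cexpD mulNr addNr cexp0 mul1r.
rewrite (eq_cint mu (fun x _ => hE x)).
have cc j := ccont_expmono a b j l.
rewrite cint_sum; last by move=> j; exact: ccontM (ccont_cst _ _) (cc j).
rewrite big1// => j _; rewrite cintZ; last exact: cc.
by have := ml j (ltn_ord j); rewrite /moment => ->; rewrite mulr0.
Qed.

(** The induction runs over a duplicate-free list of indices: distinct roots make each new factor
    coprime to the product of those in the tail. *)
Lemma annihilates_prod (k : nat) (lam : 'I_k -> R[i]) (m : 'I_k -> nat) :
  injective lam ->
  (forall i j, (j < m i)%N -> moment mu a b j (lam i) = 0) ->
  annihilates (\prod_(i < k) ('X - (lam i)%:P) ^+ m i).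
Proof.
move=> lam_inj mom.
have : uniq (index_enum 'I_k) by exact: index_enum_uniq.
elim: (index_enum _) => [_|i s IH /= /andP[si us]].
  by rewrite big_nil; exact: annihilates1.
rewrite big_cons; apply: annihilatesM; last exact: IH.
  elim: s si {us IH} => [_|j s IH]; first by rewrite big_nil coprimep1.
  rewrite inE negb_or => /andP[ij /IH h]; rewrite big_cons coprimepMr h andbT.
  apply: coprimep_expl; apply: coprimep_expr.
  by rewrite coprimep_XsubC root_XsubC (inj_eq lam_inj) eq_sym.
by apply: annihilates_XsubC_exp => j; exact: mom.
Qed.

End annihilation.

(** A nonzero difference would have the roots 0, 1, 2, ..., as many as its size, hence more than its
    degree. *)
Lemma eq_poly_horner (F : numDomainType) (P Q : {poly F}) :
  (forall x, P.[x] = Q.[x]) -> P = Q.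
Proof.
move=> PQ; apply/eqP; rewrite -subr_eq0; apply: contraT => PQ0.
have := max_poly_roots (rs := [seq i%:R | i <- iota 0 (size (P - Q))]) PQ0.
rewrite size_map size_iota ltnn => -> //.
- by apply/allP => x _; rewrite rootE !hornerE PQ subrr.
- by rewrite map_inj_uniq ?iota_uniq//; exact: mulrIn (oner_neq0 _).
Qed.

(** * Smoothness of the characteristic solution *)

Section characteristic_jet.
Context {R : realType}.

Definition cderive (f : R -> R[i]) (x : R) : R[i] :=
  (Re \o f)^`()%classic x +i* (Im \o f)^`()%classic x.

Lemma cderiveE (f : R -> R[i]) (x : R) (d : R[i]) :
  is_cderive f x d -> cderive f x = d.
Proof.
move=> [fr fi]; rewrite /cderive !derive1E.
rewrite (derive_val (is_derive := fr)) (derive_val (is_derive := fi)).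
by case: d {fr fi}.
Qed.

(* Solving the equation for the leading derivative bootstraps the regularity
   of the solution from C^n to smoothness. *)
Lemma characteristic_jet (n : nat) (c : 'I_n.+1 -> R[i]) (w : R -> R[i]) :
  c ord_max = 1 -> characteristic_solution c w ->
  exists h : nat -> R -> R[i],
  [/\ jet h, h 0%N = w,
      forall k x, \sum_(i < n.+1) c i * h (k + i)%N x = 0 &
      forall i, (i < n)%N -> h i 0 = (i == n.-1)%:R].
Proof.
move=> c1 [[dw _] ode ini]; pose h k := iter k cderive w.
have hW i : (i <= n)%N -> h i = derive_onn setT i w.
  elim: i => [//|i IH] ilt; apply/funext => x.
  rewrite /h /= -/(h i) (IH (ltnW ilt)); apply: cderiveE.
  by apply: derivable_on_is_cderive; [exact: filterT|exact: dw].
pose c' (i : 'I_n) := c (widen_ord (leqnSn n) i).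
have sumE k x : \sum_(i < n.+1) c i * h (k + i)%N x =
    \sum_(i < n) c' i * h (k + i)%N x + h (k + n)%N x.
  by rewrite big_ord_recr /= c1 mul1r.
(* Both parts advance together: the equation writes the derivative of order j + n through lower
   ones, which are differentiable, so it is differentiable as well, and differentiating gives the
   equation for j + 1. *)
have key j : (forall x, h (j + n)%N x = \sum_(i < n) (- c' i) * h (j + i)%N x) /\
    (forall k, (k < j + n)%N -> forall x, is_cderive (h k) x (h k.+1 x)).
  elim: j => [|j [IHe IHd]].
    split => [x|k kn x].
      apply/eqP; rewrite -subr_eq0 -sumrN; apply/eqP.
      under eq_bigr do rewrite mulNr opprK; rewrite addrC -sumE -[RHS](ode x).
      by apply: eq_bigr => i _; rewrite hW// -ltnS; exact: ltn_ord.
    rewrite !hW ?(ltnW kn)//; apply: derivable_on_is_cderive; first exact: filterT.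
    exact: dw.
  have dn x : is_cderive (h (j + n)%N) x
      (\sum_(i < n) (- c' i) * h (j.+1 + i)%N x).
    rewrite (_ : h (j + n)%N = fun y => \sum_(i < n) (- c' i) * h (j + i)%N y).
      apply: (@is_cderive_sum _ _ _ (fun i : 'I_n => fun y => - c' i * h (j + i)%N y)
        (fun i : 'I_n => fun y => - c' i * h (j.+1 + i)%N y)) => i.
      by apply: is_cderiveZ; apply: IHd; rewrite ltn_add2l.
    by apply/funext.
  have en x : h (j.+1 + n)%N x = \sum_(i < n) (- c' i) * h (j.+1 + i)%N x.
    exact: cderiveE.
  split => // k; rewrite addSn ltnS leq_eqVlt => /predU1P[-> x|]; last exact: IHd.
  by rewrite -addSn en.
exists h; split => //.
- by move=> k x; apply: (key k.+1).2; rewrite addSn ltnS leq_addr.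
- move=> k x; rewrite sumE (key k).1 -big_split big1// => i _ /=.
  by rewrite mulNr subrr.
- by move=> i ilt; rewrite hW 1?ltnW// ini.
Qed.

End characteristic_jet.

(** * Lagrange's identity *)

Lemma ccontS (R : realType) (A B : set R) (f : R -> R[i]) :
  A `<=` B -> ccont B f -> ccont A f.
Proof. by move=> AB [fr fi]; split; exact: continuous_subspaceW AB _. Qed.

Lemma within_continuous_ccont (R : realType) (A : set R) (f : R -> R[i]) :
  {within A, continuous (f : R -> R[i]^o)} -> ccont A f.
Proof. by move=> cf; split => x; have [] := cvg_Re_Im (cf x). Qed.

Section FTC.
Context {R : realType}.

Lemma within_FTC2 (a x : R) (u U : R -> R) : a < x ->
  {within `[a, x], continuous u} -> {within `[a, x], continuous U} ->
  (forall t, a < t -> t < x -> is_derive t (1 : R) U (u t)) ->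
  \int[lebesgue_measure]_(t in `[a, x]) u t = U x - U a.
Proof.
move=> ax cu cU dU; rewrite /Rintegral (continuous_FTC2 (F := U))//.
- have [_ Ua Ux] := (continuous_within_itvP _ ax).1 cU.
  split => // t; rewrite in_itv /= => /andP[at_ tx].
  by have [] := dU _ at_ tx.
- move=> t; rewrite in_itv /= => /andP[at_ tx]; rewrite derive1E.
  by have [_ ->] := dU _ at_ tx.
Qed.

(** Differentiability is asked in the open interval only, which fits the one-sided derivatives at
    the ends. The case a = x is kept because x runs over all of [a, b]. *)
Lemma leb_cint_FTC2 (a x : R) (f F : R -> R[i]) : a <= x ->
  ccont `[a, x] f -> ccont `[a, x] F ->
  (forall t, a < t -> t < x -> is_cderive F t (f t)) ->
  leb_cint `[a, x] f = F x - F a.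
Proof.
rewrite le_eqVlt => /predU1P[<- _ _ _|ax [fr fi] [Fr Fi] dF].
  by rewrite subrr /leb_cint set_itv1 !Rintegral_set1.
have dFr t : a < t -> t < x -> is_derive t (1 : R) (Re \o F) (Re (f t)).
  by move=> h1 h2; have [] := dF _ h1 h2.
have dFi t : a < t -> t < x -> is_derive t (1 : R) (Im \o F) (Im (f t)).
  by move=> h1 h2; have [] := dF _ h1 h2.
rewrite /leb_cint (within_FTC2 ax fr Fr dFr) (within_FTC2 ax fi Fi dFi) /=.
by case: (F x) (F a) => [? ?] [? ?].
Qed.

End FTC.

Section concomitant.
Context {R : realType}.
Variables (a b : R) (n : nat) (c : 'I_n.+1 -> R[i]) (h : nat -> R -> R[i]).
Hypotheses (c1 : c ord_max = 1) (n_gt0 : (0 < n)%N) (jh : jet h).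
Hypothesis h_ode : forall k x, \sum_(i < n.+1) c i * h (k + i)%N x = 0.
Hypothesis h0 : forall i, (i < n)%N -> h i 0 = (i == n.-1)%:R.
Variable f : R -> R[i].
Let E : set R := `[a, b].
Hypothesis fC : Cn_on E n f.

Let F j := derive_onn E j f.

(* The bilinear concomitant of Lagrange's identity for the operator with
   coefficients [c], evaluated at f and the adjoint solution t |-> h 0 (x - t). *)
Definition concomitant (x t : R) : R[i] :=
  \sum_(i < n.+1) c i * \sum_(j < i) h (i - j.+1)%N (x - t) * F j t.

Lemma is_cderive_reflect k x t :
  is_cderive (fun s => h k (x - s)) t (- h k.+1 (x - t)).
Proof.
have dr : is_derive t (1 : R) (fun s : R => x - s) (- 1).
  by rewrite -[- 1]add0r; apply: is_deriveB.
apply: is_cderive_eq (@is_cderive_comp _ _ (fun s => x - s) _ _ _ (jh k _) dr) _.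
by rewrite rmorphN1 mulrN1.
Qed.

Lemma ccont_shift k t : ccont E (fun x => h k (x - t)).
Proof.
apply: (@is_cderive_ccont _ _ (fun x => h k.+1 (x - t))) => x.
have dr : is_derive x (1 : R) (fun s : R => s - t) 1.
  by rewrite -[X in is_derive _ _ _ X]subr0; apply: is_deriveB.
apply: is_cderive_eq (@is_cderive_comp _ _ (fun s => s - t) _ _ _ (jh k _) dr) _.
by rewrite mulr1.
Qed.

Lemma ccont_derive_onn j : (j <= n)%N -> ccont E (F j).
Proof.
have [df cf] := fC; rewrite leq_eqVlt => /predU1P[->|jn].
  exact: within_continuous_ccont.
by apply: derivable_on_ccont => x Ex; exact: df.
Qed.

Lemma ccont_diff_op : ccont E (diff_op E c f).
Proof.
apply: (@ccont_sum _ _ _ _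
  (fun i : 'I_n.+1 => fun t => c i * derive_onn E i f t)) => i.
apply: ccontM; first exact: ccont_cst.
by apply: ccont_derive_onn; rewrite -ltnS.
Qed.

Lemma ccont_concomitant x : ccont E (concomitant x).
Proof.
apply: (@ccont_sum _ _ _ _ (fun i : 'I_n.+1 => fun t =>
  c i * \sum_(j < i) h (i - j.+1)%N (x - t) * F j t)) => i.
apply: ccontM; first exact: ccont_cst.
apply: (@ccont_sum _ _ _ _ (fun j : 'I_i => fun t =>
  h (i - j.+1)%N (x - t) * F j t)) => j.
apply: ccontM; last first.
  apply: ccont_derive_onn; rewrite -ltnS; apply: leq_trans (ltn_ord i).
  by rewrite ltnW// ltnS ltn_ord.
by apply: is_cderive_ccont => t; exact: is_cderive_reflect.
Qed.

(** With [G i j] = h_(i-j)(x - t) F_j(t), each summand has derivative G i (j+1) - G i j. The inner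
    sum telescopes to h_0 F_i - h_i F_0, and the terms c_i h_i F_0 add up to zero by the equation at
    x - t. *)
Lemma is_cderive_concomitant x t : a < t -> t < b ->
  is_cderive (concomitant x) t (h 0%N (x - t) * diff_op E c f t).
Proof.
move=> at_ tb.
have dF j : (j < n)%N -> is_cderive (F j) t (F j.+1 t).
  move=> jn; apply: derivable_on_is_cderive.
      apply: filterS (near_in_itvoo (a := a) (b := b) (x := t) _).
      by move=> s; rewrite /E /= !in_itv /= => /andP[/ltW-> /ltW->].
    by rewrite in_itv /= at_ tb.
  by apply: fC.1 => //; rewrite /E /= in_itv /= !ltW.
pose G i j := h (i - j)%N (x - t) * F j t.
have dterm (i : 'I_n.+1) (j : 'I_i) :
    is_cderive (fun s => h (i - j.+1)%N (x - s) * F j s) t (G i j.+1 - G i j).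
  have jn : (j < n)%N by apply: leq_trans (ltn_ord j) _; rewrite -ltnS.
  apply: is_cderive_eq (is_cderiveM (is_cderive_reflect _ _ _) (dF _ jn)) _.
  by rewrite /G subnSK// mulNr addrC.
have : is_cderive (concomitant x) t
    (\sum_(i < n.+1) c i * \sum_(j < i) (G i j.+1 - G i j)).
  apply: (@is_cderive_sum _ _ _ (fun i : 'I_n.+1 => fun s =>
    c i * \sum_(j < i) h (i - j.+1)%N (x - s) * F j s)
    (fun i : 'I_n.+1 => fun _ => c i * \sum_(j < i) (G i j.+1 - G i j))) => i.
  apply: is_cderiveZ.
  exact: (@is_cderive_sum _ _ _ (fun j : 'I_i => fun s =>
    h (i - j.+1)%N (x - s) * F j s) (fun j : 'I_i => fun _ => G i j.+1 - G i j)).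
move=> /is_cderive_eq; apply.
under eq_bigr do rewrite -(big_mkord xpredT (fun j => G _ j.+1 - G _ j))
  telescope_sumr// /G subnn subn0 mulrBr.
rewrite sumrB.
have -> : \sum_(i < n.+1) c i * (h i (x - t) * F 0 t) = 0.
  under eq_bigr do rewrite mulrA; rewrite -mulr_suml.
  by have := h_ode 0 (x - t) => /= ->; rewrite mul0r.
by rewrite subr0 /diff_op mulr_sumr; apply: eq_bigr => i _; rewrite mulrCA.
Qed.

(** At t = x the initial values keep only the terms with i - j - 1 = n - 1. This forces i = n and j
    = 0, whose coefficient c_n is 1. *)
Lemma concomitant_diag x : concomitant x x = f x.
Proof.
have F0 l : (l < n)%N -> h l (x - x) = (l == n.-1)%:R.
  by rewrite subrr; exact: h0.
rewrite /concomitant big_ord_recr /= c1 mul1r big1 ?add0r; last first.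
  move=> i _; rewrite big1 ?mulr0// => j _.
  rewrite F0; last by apply: leq_ltn_trans (leq_subr _ _) _.
  rewrite (_ : (_ == _) = false) ?mul0r//.
  by have := ltn_ord i; have := ltn_ord j; lia.
rewrite (bigD1 (Ordinal n_gt0))//= F0; last by lia.
rewrite subn1 eqxx mul1r big1 ?addr0// => j j0.
have {}j0 : (0 < j)%N by rewrite lt0n.
rewrite F0; last by have := ltn_ord j; lia.
rewrite (_ : (_ == _) = false) ?mul0r//.
by have := ltn_ord j; lia.
Qed.

Lemma concomitant_FTC x : E x ->
  leb_cint `[a, x] (fun t => h 0%N (x - t) * diff_op E c f t) =
  f x - concomitant x a.
Proof.
rewrite /E /= in_itv /= => /andP[ax xb].
have sub : `[a, x] `<=` E.
  by apply: subset_itvl; rewrite bnd_simp.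
rewrite (leb_cint_FTC2 (F := concomitant x)) ?concomitant_diag//.
- apply: ccontM; last exact: ccontS sub ccont_diff_op.
  by apply: is_cderive_ccont => t; exact: is_cderive_reflect.
- exact: ccontS sub (ccont_concomitant x).
- by move=> t at_ tx; apply: is_cderive_concomitant => //; exact: lt_le_trans xb.
Qed.

End concomitant.

(** * Exchange of the order of integration *)

Section triangle_Fubini.
Context {R : realType}.
Variable nu : {finite_measure set (measurableTypeR R) -> \bar R}.
Variables (a b M : R) (phi : measurableTypeR R * measurableTypeR R -> R).
Hypothesis mphi : measurable_fun setT phi.
Let E : set (measurableTypeR R) := `[a, b].
Hypothesis phiM : forall x t, E x -> E t -> t <= x -> `|phi (x, t)| <= M.

Let mu := @lebesgue_measure R.

Let D : set (measurableTypeR R * measurableTypeR R) :=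
  (E `*` E) `&` [set p | p.2 <= p.1].

Let lebesgue_measure_itv_lty (c d : R) : (mu `[c, d]%classic < +oo)%E.
Proof.
by rewrite /mu lebesgue_measure_itv; case: ifP => _; rewrite ltry.
Qed.

Let mE : measurable E. Proof. exact: measurable_itv. Qed.

Let mD : measurable D.
Proof.
apply: measurableI; first exact: measurableX.
rewrite -[X in measurable X]setTI.
exact: (@measurable_fun_le _ (measurableTypeR R * measurableTypeR R)%type R setT
  snd fst measurableT measurable_snd measurable_fst).
Qed.

(** Extension by zero off the triangle turns integrals over the moving intervals [a, x] and [t, b]
    into slices of one product integral. *)
Let psi : measurableTypeR R * measurableTypeR R -> \bar R := (EFin \o phi) \_ D.

Let psi_integrable : (nu \x mu)%E.-integrable setT psi.
Proof.
apply/(integrable_mkcond _ mD).1; apply: measurable_bounded_integrable => //.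
- apply: (@le_lt_trans _ _ ((nu \x mu)%E (E `*` E)))%E.
    apply: le_measure; rewrite ?inE//; first exact: measurableX.
    exact: subIsetl.
  rewrite product_measure1E//; apply: lte_mul_pinfty => //.
    by rewrite fin_num_measure.
  exact: lebesgue_measure_itv_lty.
- exact: measurable_funS mphi.
- exists M; split; first exact: num_real.
  move=> N MN [x t] [[/= Ex Et] tx].
  by apply: le_trans (ltW MN); exact: phiM.
Qed.

Let inner1 x : (\int[mu]_t psi (x, t))%E =
  ((fun x => \int[mu]_(t in `[a, x]) (phi (x, t))%:E) \_ E x)%E.
Proof.
rewrite patchE; case: ifPn => [/set_mem Ex|/negP Ex]; last first.
  rewrite integral0_eq// => t _; rewrite /psi patchE ifF//.
  by apply/negP => /set_mem[[/= /mem_set]].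
rewrite [RHS]integral_mkcond; apply: eq_integral => t _; rewrite /psi !patchE.
congr (if _ then _ else _).
move: Ex; rewrite /E /= in_itv /= => /andP[ax xb].
apply/idP/idP => /set_mem.
- move=> [[_ /=]]; rewrite /E /= in_itv /= => /andP[at_ _] tx.
  by apply/mem_set; rewrite /= in_itv /= at_.
- rewrite /= in_itv /= => /andP[at_ tx].
  apply/mem_set; rewrite /D /E /=; split => //=; split; rewrite /= in_itv /=.
    by rewrite ax.
  by rewrite at_ (le_trans tx).
Qed.

Let inner2 t : (\int[nu]_x psi (x, t))%E =
  ((fun t => \int[nu]_(x in `[t, b]) (phi (x, t))%:E) \_ E t)%E.
Proof.
rewrite patchE; case: ifPn => [/set_mem Et|/negP Et]; last first.
  rewrite integral0_eq// => x _; rewrite /psi patchE ifF//.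
  by apply/negP => /set_mem[[/= _ /mem_set]].
rewrite [RHS]integral_mkcond; apply: eq_integral => x _; rewrite /psi !patchE.
congr (if _ then _ else _).
move: Et; rewrite /E /= in_itv /= => /andP[at_ tb].
apply/idP/idP => /set_mem.
- move=> [[/= + _]]; rewrite /E /= in_itv /= => /andP[_ xb] tx.
  by apply/mem_set; rewrite /= in_itv /= tx.
- rewrite /= in_itv /= => /andP[tx xb].
  apply/mem_set; rewrite /D /E /=; split => //=; split; rewrite /= in_itv /=.
    by rewrite (le_trans at_).
  by rewrite at_.
Qed.

Let slice_bound (m : {measure set (measurableTypeR R) -> \bar R}) (c d : R)
    (u : R -> R) :
  (m `[c, d]%classic < +oo)%E ->
  measurable_fun (setT : set (measurableTypeR R)) u ->
  (forall t, `[c, d]%classic t -> `|u t| <= M) ->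
  (\int[m]_(t in `[c, d]) (u t)%:E)%E \is a fin_num.
Proof.
move=> mfin mu' uM; apply: integrable_fin_num; first exact: measurable_itv.
apply: measurable_bounded_integrable => //.
  exact: measurable_funS mu'.
exists M; split; first exact: num_real.
by move=> N MN t /uM h; apply: le_trans (ltW MN).
Qed.

Let fin1 x : E x -> (\int[mu]_(t in `[a, x]) (phi (x, t))%:E)%E \is a fin_num.
Proof.
move=> Ex; apply: (@slice_bound mu a x (fun t => phi (x, t))).
- exact: lebesgue_measure_itv_lty.
- exact: measurableT_comp mphi (pair1_measurable x).
- move=> t /=; rewrite in_itv /= => /andP[at_ tx]; apply: phiM => //.
  move: Ex; rewrite /E /= !in_itv /= => /andP[_ xb].
  by rewrite at_ (le_trans tx).
Qed.

Let fin2 t : E t -> (\int[nu]_(x in `[t, b]) (phi (x, t))%:E)%E \is a fin_num.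
Proof.
move=> Et; apply: (@slice_bound nu t b (fun x => phi (x, t))).
- by rewrite ltey_eq fin_num_measure//; exact: measurable_itv.
- exact: measurableT_comp mphi (pair2_measurable t).
- move=> x /=; rewrite in_itv /= => /andP[tx xb]; apply: phiM => //.
  move: Et; rewrite /E /= !in_itv /= => /andP[at_ _].
  by rewrite (le_trans at_).
Qed.

Lemma triangle_Fubini :
  \int[nu]_(x in E) (\int[mu]_(t in `[a, x]) phi (x, t)) =
  \int[mu]_(t in E) (\int[nu]_(x in `[t, b]) phi (x, t)).
Proof.
rewrite /Rintegral; congr fine.
(* The inner real integrals are [fine] of extended ones; their finiteness is needed to drop [fine]
   before applying Fubini. *)
under eq_integral => x /set_mem Ex do rewrite (fineK (fin1 Ex)).
under [RHS]eq_integral => t /set_mem Et do rewrite (fineK (fin2 Et)).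
rewrite integral_mkcond [RHS]integral_mkcond.
under eq_integral do rewrite -inner1.
under [RHS]eq_integral do rewrite -inner2.
exact: Fubini psi_integrable.
Qed.

(** Atoms of [nu] can make this function of t discontinuous, so integrability is drawn from that of
    [psi] on the product. *)
Lemma triangle_integrable : mu.-integrable E
  (EFin \o (fun t => \int[nu]_(x in `[t, b]) phi (x, t))).
Proof.
apply: eq_integrable (_ : mu.-integrable E (fun t => \int[nu]_x psi (x, t)))%E.
- exact: mE.
- by move=> t Et; rewrite inner2 patchE Et /= fineK// fin2//; exact: set_mem.
- apply: (@integrableS _ _ _ _ setT) => //.
  have mpsi := measurable_int _ psi_integrable.
  apply/integrableP; split; first exact: measurable_fubini_G psi_integrable.
  have h := (integrable21ltyP _ _ mpsi).1 psi_integrable.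
  apply: le_lt_trans h.
  apply: ge0_le_integral => //.
  + by apply: measurableT_comp => //; exact: measurable_fubini_G psi_integrable.
  + apply: (measurable_fun_fubini_tonelli_G (abse \o psi)) => //=.
    exact: measurableT_comp.
  + move=> t _; apply: le_abse_integral => //.
    exact: measurableT_comp mpsi (pair2_measurable t).
Qed.

End triangle_Fubini.

Lemma ccont_bounded (R : realType) (a b : R) (f : R -> R[i]) :
  ccont `[a, b] f ->
  exists2 M, 0 <= M & forall x, `[a, b]%classic x -> normc (f x) <= M.
Proof.
have bnd (u : R -> R) : {within `[a, b], continuous u} ->
    exists2 M, 0 <= M & forall x, `[a, b]%classic x -> `|u x| <= M.
  move=> cu; have [M [_ HM]] :=
    compact_bounded (continuous_compact cu (@segment_compact _ a b)).
  exists (`|M| + 1) => [|x abx]; first by rewrite addr_ge0.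
  by apply: (HM (`|M| + 1)); [rewrite ltr_pwDr// ler_norm|exists x].
move=> [/bnd[M1 M10 h1] /bnd[M2 M20 h2]].
exists (M1 + M2) => [|x abx]; first by rewrite addr_ge0.
by apply: le_trans (normc_le _) _; apply: lerD; [exact: h1|exact: h2].
Qed.

Section complex_triangle_Fubini.
Context {R : realType}.
Variable nu : {finite_measure set (measurableTypeR R) -> \bar R}.
Variables (a b : R) (w H : R -> R[i]).
Hypotheses (cw : ccont setT w) (cH : ccont `[a, b] H).
Let E : set R := `[a, b].

(** [H] is controlled on [a, b] only, whereas Fubini wants a kernel measurable on the whole
    plane. *)
Let HE (t : R) : R[i] := if t \in E then H t else 0.

Let measurable_HE : measurable_fun setT (Re \o HE : measurableTypeR R -> R) /\
  measurable_fun setT (Im \o HE : measurableTypeR R -> R).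
Proof.
have mE : measurable (E : set (measurableTypeR R)) by exact: measurable_itv.
have [hr hi] := cH.
split.
- rewrite (_ : _ \o _ = (Re \o H) \_ E); last first.
    by apply/funext => t; rewrite patchE /HE /=; case: ifP.
  by apply/(measurable_restrictT _ mE); exact: subspace_continuous_measurable_fun.
- rewrite (_ : _ \o _ = (Im \o H) \_ E); last first.
    by apply/funext => t; rewrite patchE /HE /=; case: ifP.
  by apply/(measurable_restrictT _ mE); exact: subspace_continuous_measurable_fun.
Qed.

Let T2 := (measurableTypeR R * measurableTypeR R)%type.

Let measurable_w : measurable_fun setT (fun p : T2 => Re (w (p.1 - p.2))) /\
  measurable_fun setT (fun p : T2 => Im (w (p.1 - p.2))).
Proof.
have msub : measurable_fun setT (fun p : T2 => (p.1 : R) - p.2).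
  by apply: measurable_funB; [exact: measurable_fst|exact: measurable_snd].
have [wr wi] := cw.
have mw (u : R -> R) : {within setT, continuous u} -> measurable_fun setT u.
  by move=> cu; apply: subspace_continuous_measurable_fun.
by split; [exact: measurableT_comp (mw _ wr) msub
  |exact: measurableT_comp (mw _ wi) msub].
Qed.

Let F (p : T2) : R[i] := w (p.1 - p.2) * HE p.2.

Let measurable_F : measurable_fun setT (fun p => Re (F p)) /\
  measurable_fun setT (fun p => Im (F p)).
Proof.
have [wr wi] := measurable_w; have [hr hi] := measurable_HE.
have hr2 := measurableT_comp hr (@measurable_snd _ _ (measurableTypeR R) _).
have hi2 := measurableT_comp hi (@measurable_snd _ _ (measurableTypeR R) _).
split.
- rewrite (_ : (fun _ => _) = (fun p : T2 => Re (w (p.1 - p.2)) * Re (HE p.2) -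
    Im (w (p.1 - p.2)) * Im (HE p.2))).
    by apply: measurable_funB; apply: measurable_funM.
  by apply/funext => p; rewrite /F Re_mul.
- rewrite (_ : (fun _ => _) = (fun p : T2 => Re (w (p.1 - p.2)) * Im (HE p.2) +
    Im (w (p.1 - p.2)) * Re (HE p.2))).
    by apply: measurable_funD; apply: measurable_funM.
  by apply/funext => p; rewrite /F Im_mul.
Qed.

Let bounded_F : exists M : R, forall x t, E x -> E t -> t <= x ->
  normc (F (x, t)) <= M.
Proof.
(* On the triangle x - t stays in the compact interval [0, b - a]. *)
have [M1 M10 h1] := ccont_bounded (ccontS (@subsetT _ `[0, b - a]) cw).
have [M2 M20 h2] := ccont_bounded cH.
exists (M1 * M2) => x t Ex Et tx; rewrite /F normcM /= /HE mem_set//.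
apply: ler_pM; rewrite ?normc_ge0//; last exact: h2.
apply: h1; move: Ex Et; rewrite /E /= !in_itv /= => /andP[ax xb] /andP[at_ tb].
by lra.
Qed.

Let FE (x t : R) : E t -> F (x, t) = w (x - t) * H t.
Proof. by move=> Et; rewrite /F /HE /= mem_set. Qed.

Lemma mint_leb_cint :
  mint nu E (fun x => leb_cint `[a, x] (fun t => w (x - t) * H t)) =
  leb_cint E (fun t => mint nu `[t, b] (fun x => w (x - t) * H t)) /\
  cintegrable lebesgue_measure E
    (fun t => mint nu `[t, b] (fun x => w (x - t) * H t)).
Proof.
have [M FM] := bounded_F; have [mr mi] := measurable_F.
have rM x t : E x -> E t -> t <= x -> `|Re (F (x, t))| <= M.
  by move=> Ex Et tx; apply: le_trans (Re_le_normc _) (FM _ _ Ex Et tx).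
have iM x t : E x -> E t -> t <= x -> `|Im (F (x, t))| <= M.
  by move=> Ex Et tx; apply: le_trans (Im_le_normc _) (FM _ _ Ex Et tx).
have e1 x : E x -> leb_cint `[a, x] (fun t => w (x - t) * H t) =
    leb_cint `[a, x] (fun t => F (x, t)).
  move=> Ex; apply: (@eq_mint _ lebesgue_measure) => t; rewrite /= in_itv /=.
  move=> /andP[at_ tx]; rewrite FE//; move: Ex; rewrite /E /= !in_itv /=.
  by move=> /andP[_ xb]; rewrite at_ (le_trans tx).
have e2 t : E t -> mint nu `[t, b] (fun x => w (x - t) * H t) =
    mint nu `[t, b] (fun x => F (x, t)).
  by move=> Et; apply: eq_mint => x _; rewrite FE.
have mE : measurable (E : set (measurableTypeR R)) by exact: measurable_itv.
split.
  rewrite (eq_mint nu e1) [RHS](eq_mint lebesgue_measure e2).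
  by apply: complexP; rewrite /mint /leb_cint /=;
    [exact: (triangle_Fubini nu mr rM)|exact: (triangle_Fubini nu mi iM)].
split.
- apply: eq_integrable (triangle_integrable nu mr rM) => //.
  by move=> t /set_mem Et; exact: (congr1 (EFin \o Re) (esym (e2 t Et))).
- apply: eq_integrable (triangle_integrable nu mi iM) => //.
  by move=> t /set_mem Et; exact: (congr1 (EFin \o Im) (esym (e2 t Et))).
Qed.

End complex_triangle_Fubini.

(** Both sides are linear in the four measures behind [mu]. Integrability of each inner integral is
    what lets their combination pass through the Lebesgue integral. *)
Lemma cint_leb_cint (R : realType) (mu : @complex_measure R) (a b : R)
    (w H : R -> R[i]) :
  ccont setT w -> ccont `[a, b] H ->
  cint mu `[a, b] (fun x => leb_cint `[a, x] (fun t => w (x - t) * H t)) =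
  leb_cint `[a, b] (fun t => cint mu `[t, b] (fun x => w (x - t) * H t)).
Proof.
move=> cw cH; have [e [nu muE]] := cint_mint mu; rewrite muE.
have mE : measurable (`[a, b]%classic : set (measurableTypeR R)).
  exact: measurable_itv.
pose I k t := mint (nu k) `[t, b] (fun x => w (x - t) * H t).
have Ii k : cintegrable lebesgue_measure `[a, b] (I k).
  by have [] := mint_leb_cint (nu k) cw cH.
rewrite [RHS](_ : _ = mint lebesgue_measure `[a, b] (fun t => \sum_k e k * I k t)).
  rewrite (mint_sum mE); last by move=> k; exact: cintegrableZ.
  apply: eq_bigr => k _; rewrite (mintZ mE)//; congr (_ * _).
  by have [] := mint_leb_cint (nu k) cw cH.
by apply: eq_mint => t _; rewrite muE.
Qed.

(** * The representation formula *)

Theorem theorem3p1 (R : realType) (a b : R) (hab : a < b)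
  (mu : @complex_measure R) (hmu : nonzero_on a b mu)
  (k : nat) (hk : (0 < k)%N)
  (lam : 'I_k -> R[i]) (hlam : forall i, lam i \in spectral_set a b mu)
  (lam_inj : injective lam)
  (m : 'I_k -> nat) (m_gt0 : forall i, (0 < m i)%N)
  (hm : forall i, (m i <= multiplicity (spectral_fun a b mu) (lam i))%N)
  (n : nat) (hn : n = (\sum_(i < k) m i)%N)
  (c : 'I_n.+1 -> R[i])
  (hc : forall z : R[i],
     \prod_(i < k) (z - lam i) ^+ m i = \sum_(i < n.+1) c i * z ^+ i)
  (w : R -> R[i]) (hw : characteristic_solution c w)
  (g : R -> R[i])
  (hg : forall t, t \in `[a, b] -> g t = cint mu `[t, b] (fun x => w (x - t))) :
  forall f : R -> R[i], Cn_on `[a, b] n f ->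
    A_fun a b mu f = leb_cint `[a, b] (fun t => diff_op `[a, b] c f t * g t) /\
    A_fun a b mu f = C_fun a b g (diff_op `[a, b] c f).
Proof.
move=> f fC; suff fE : A_fun a b mu f =
    leb_cint `[a, b] (fun t => diff_op `[a, b] c f t * g t) by [].
pose E : set R := `[a, b]%classic.
pose P : {poly R[i]} := \prod_(i < k) ('X - (lam i)%:P) ^+ m i.
have sizeP : size P = n.+1.
  rewrite size_prod; last by move=> i _; rewrite expf_neq0// polyXsubC_eq0.
  under eq_bigr do rewrite size_exp_XsubC -addn1.
  by rewrite big_split /= -hn sum1_card -addSn addnK.
(* [hc] equates values only; over an infinite domain this identifies the coefficients, and monicity
   of [P] then gives c_n = 1. *)
have PE : P = \poly_(i < n.+1) c (inord i).
  apply: eq_poly_horner => z; rewrite horner_poly /P horner_prod.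
  under eq_bigr do rewrite horner_exp !hornerE.
  by rewrite hc; apply: eq_bigr => i _; rewrite inord_val.
have coefP (i : 'I_n.+1) : P`_i = c i.
  by rewrite PE coef_poly ltn_ord inord_val.
have c1 : c ord_max = 1.
  have : P \is monic by apply: monic_prod => i _; exact/monic_exp/monicXsubC.
  by move=> /monicP; rewrite lead_coefE sizeP -coefP.
have n_gt0 : (0 < n)%N.
  by rewrite hn (bigD1 (Ordinal hk)) //= ltn_addr.
have [h [jh hw0 ode h0]] := characteristic_jet c1 hw.
(* A constant coefficient operator commutes with differentiation and translation, so the shifted
   sequence [hl] is again a solution. *)
have kill l : cint mu E (fun x => h l (x - a)) = 0.
  have aP := annihilates_prod (mu := mu) (a := a) (b := b) lam_inj
    (fun i j => moment_eq0 (hm i)).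
  pose hl (j : nat) (x : R) := h (l + j)%N (x - a).
  have jhl : jet hl.
    move=> j x; rewrite /hl.
    have dr : is_derive x (1 : R) (fun s : R => s - a) 1.
      by rewrite -[X in is_derive _ _ _ X]subr0; apply: is_deriveB.
    apply: is_cderive_eq
      (@is_cderive_comp _ _ (fun s => s - a) _ _ _ (jh _ _) dr) _.
    by rewrite mulr1 addnS.
  have := aP hl jhl; rewrite /hl addn0; apply => j x.
  rewrite /pact -/P sizeP -[RHS](ode (l + j)%N (x - a)).
  by apply: eq_bigr => i _; rewrite coefP addnA.
pose B x := concomitant a b c h f x a.
pose D t := diff_op E c f t.
have cB : ccont E B.
  apply: (@ccont_sum _ _ _ _ (fun i : 'I_n.+1 => fun x =>
    c i * \sum_(j < i) h (i - j.+1)%N (x - a) * derive_onn E j f a)) => i.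
  apply: ccontM; first exact: ccont_cst.
  apply: (@ccont_sum _ _ _ _ (fun j : 'I_i => fun x =>
    h (i - j.+1)%N (x - a) * derive_onn E j f a)) => j.
  by apply: ccontM; [exact: ccont_shift|exact: ccont_cst].
have cf : ccont E f by exact: (ccont_derive_onn fC (leq0n n)).
have B0 : cint mu E B = 0.
  rewrite /B /concomitant cint_sum.
    rewrite big1// => i _; rewrite cintZ.
      rewrite cint_sum; last first.
        by move=> j; apply: ccontM; [exact: ccont_shift|exact: ccont_cst].
      rewrite big1 ?mulr0// => j _.
      under eq_cint do rewrite mulrC.
      by rewrite cintZ ?kill ?mulr0//; exact: ccont_shift.
    apply: (@ccont_sum _ _ _ _ (fun j : 'I_i => fun x =>
      h (i - j.+1)%N (x - a) * derive_onn E j f a)) => j.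
    by apply: ccontM; [exact: ccont_shift|exact: ccont_cst].
  move=> i; apply: ccontM; first exact: ccont_cst.
  apply: (@ccont_sum _ _ _ _ (fun j : 'I_i => fun x =>
    h (i - j.+1)%N (x - a) * derive_onn E j f a)) => j.
  by apply: ccontM; [exact: ccont_shift|exact: ccont_cst].
rewrite /A_fun -/E.
(* Subtracting the boundary term costs nothing under mu, and f - B is pointwise the integral over
   [a, x] given by [concomitant_FTC]. *)
have -> : cint mu E f = cint mu E (fun x => f x + -1 * B x).
  rewrite cintD//; last by apply: ccontM => //; exact: ccont_cst.
  by rewrite cintZ// B0 mulr0 addr0.
rewrite (@eq_cint _ _ _ _
  (fun x => leb_cint `[a, x] (fun t => w (x - t) * D t))); last first.
  move=> x Ex; rewrite -hw0 mulN1r.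
  exact/esym/(concomitant_FTC c1 n_gt0 jh ode h0 fC Ex).
have cw : ccont setT w.
  by rewrite -hw0; exact: is_cderive_ccont (jh 0%N).
rewrite cint_leb_cint//; last exact: ccont_diff_op.
apply: (@eq_mint _ lebesgue_measure) => t Et.
(* For fixed t the factor [D t] is constant in x and leaves the integral over [t, b]; what remains
   is [g t]. *)
rewrite hg; last exact: Et.
under eq_cint do rewrite mulrC.
rewrite cintZ// -hw0; exact: ccont_shift.
Qed.
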